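(* Let $x: M \rightarrow \mathbb{E}^4$ be an isometric immersion of a connected Riemannian surface with conformal Laplace transformation. Then the Laplace image $L(M)$ of $x$ is a minimal surface of a hypersphere of $\mathbb{E}^4$ centered at the origin if and only if $M$ is a minimal surface of a hypersphere of $\mathbb{E}^4$.
   Context: Manifolds and immersions are smooth and connected. $\Delta=-\operatorname{trace}\nabla^2$ is the Laplace operator of $M$. The Laplace map is $L:M\to\mathbb{E}^4$, $L(p)=(\Delta x)(p)=-2H(p)$ with $H=\frac12\operatorname{trace}h$ the mean curvature vector; the Laplace transformation $\mathcal L:M\to L(M)$ is $L$ regarded as a map onto its image. $\mathcal L$ is conformal if there is a strictly positive function $\rho$ on $M$ with $\langle dL(X),dL(Y)\rangle=\rho^2\langle X,Y\rangle$ for all tangent vectors $X,Y$ at a common point; then $L$ is an immersion, and minimality of $L(M)$ in a hypersphere is understood for the immersion $L$ with its induced metric. In the second condition the hypersphere containing $M$ may have any center and radius. *)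

(* Defs.v *)
From mathcomp Require Import all_boot all_order all_algebra.
From mathcomp Require Import all_classical all_reals all_analysis.
Import Order.TTheory GRing.Theory Num.Theory.
Import numFieldNormedType.Exports.

Set Implicit Arguments.
Unset Strict Implicit.
Unset Printing Implicit Defensive.

Local Open Scope classical_set_scope.
Local Open Scope ring_scope.

Definition dot (R : realType) (n : nat) (u v : 'rV[R]_n) : R :=
  \sum_(i < n) u 0 i * v 0 i.

(* U is meant to be open. *)
Fixpoint Ck_on (R : realType) (V W : normedModType R) (k : nat) (U : set V)
    (f : V -> W) : Prop :=
  match k with
  | 0 => forall u, U u -> {for u, continuous f}
  | k'.+1 => (forall u, U u -> differentiable f u) /\
             (forall v : V, Ck_on k' U (fun u => 'D_v f u))
  end.

Definition smooth_on (R : realType) (V W : normedModType R) (U : set V)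
    (f : V -> W) : Prop := forall k, Ck_on k U f.

(* [coord] and [param] are total; only their values on [dom] and [img] matter. *)
Record chart (R : realType) (T : topologicalType) := Chart {
  dom : set T;
  img : set 'rV[R]_2;
  coord : T -> 'rV[R]_2;
  param : 'rV[R]_2 -> T;
  dom_open : open dom;
  img_open : open img;
  coord_img : forall p, dom p -> img (coord p);
  param_dom : forall u, img u -> dom (param u);
  coordK : forall p, dom p -> param (coord p) = p;
  paramK : forall u, img u -> coord (param u) = u;
  coord_continuous : forall p, dom p -> {for p, continuous coord};
  param_continuous : forall u, img u -> {for u, continuous param}
}.

Definition transition (R : realType) (T : topologicalType) (c d : chart R T)
    : 'rV[R]_2 -> 'rV[R]_2 := coord d \o param c.

Record surface (R : realType) := Surface {
  carrier :> topologicalType;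
  atlas : set (chart R carrier);
  chart_at : carrier -> chart R carrier;
  chart_at_atlas : forall p, atlas (chart_at p);
  chart_at_dom : forall p, dom (chart_at p) p;
  atlas_smooth : forall c d, atlas c -> atlas d ->
    smooth_on (img c `&` param c @^-1` dom d) (transition c d);
  surface_hausdorff : hausdorff_space carrier;
  surface_second_countable : @second_countable carrier;
  surface_connected : connected [set: carrier];
  surface_nonempty : [set: carrier] !=set0
}.

Definition bilin (R : realType) (G : 'M[R]_2) (v w : 'rV[R]_2) : R :=
  (v *m G *m w^T) 0 0.

(* [gmat c u] is the matrix (g_ij) in the chart c at the point with
   coordinates u. *)
Record riemannian_metric (R : realType) (M : surface R) := RiemannianMetric {
  gmat : chart R M -> 'rV[R]_2 -> 'M[R]_2;
  gmat_smooth : forall c, atlas c -> smooth_on (img c) (gmat c);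
  gmat_sym : forall c u, atlas c -> img c u -> (gmat c u)^T = gmat c u;
  gmat_pos : forall c u (v : 'rV[R]_2), atlas c -> img c u -> v != 0 ->
    0 < bilin (gmat c u) v v;
  gmat_transition : forall c d p (v w : 'rV[R]_2),
    atlas c -> atlas d -> dom c p -> dom d p ->
    bilin (gmat c (coord c p)) v w =
    bilin (gmat d (coord d p)) ('D_v (transition c d) (coord c p))
                               ('D_w (transition c d) (coord c p))
}.

(* Tangent vectors at p are represented by their components v : 'rV_2 in a
   chart c around p. *)
Definition tangent_map (R : realType) (M : surface R) (n : nat)
    (f : M -> 'rV[R]_n) (c : chart R M) (p : M) (v : 'rV[R]_2) : 'rV[R]_n :=
  'D_v (f \o param c) (coord c p).

Definition smooth_map (R : realType) (M : surface R) (n : nat)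
    (f : M -> 'rV[R]_n) : Prop :=
  forall c, atlas c -> smooth_on (img c) (f \o param c).

Definition immersion (R : realType) (M : surface R) (n : nat)
    (f : M -> 'rV[R]_n) : Prop :=
  smooth_map f /\
  forall c p, atlas c -> dom c p -> injective (tangent_map f c p).

Definition isometric_immersion (R : realType) (M : surface R)
    (g : riemannian_metric M) (n : nat) (f : M -> 'rV[R]_n) : Prop :=
  immersion f /\
  forall c p (v w : 'rV[R]_2), atlas c -> dom c p ->
    dot (tangent_map f c p v) (tangent_map f c p w) =
    bilin (gmat g c (coord c p)) v w.

Definition conformal (R : realType) (M : surface R)
    (g : riemannian_metric M) (n : nat) (f : M -> 'rV[R]_n) : Prop :=
  exists rho : M -> R, (forall p, 0 < rho p) /\
    forall c p (v w : 'rV[R]_2), atlas c -> dom c p ->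
      dot (tangent_map f c p v) (tangent_map f c p w) =
      rho p ^+ 2 * bilin (gmat g c (coord c p)) v w.

Definition pd (R : realType) (W : normedModType R) (i : 'I_2)
    (F : 'rV[R]_2 -> W) (u : 'rV[R]_2) : W :=
  'D_(delta_mx 0 i : 'rV[R]_2) F u.

(* Gamma^k_ij of the Levi-Civita connection of the metric (G_ij). *)
Definition christoffel (R : realType) (G : 'rV[R]_2 -> 'M[R]_2)
    (k i j : 'I_2) (u : 'rV[R]_2) : R :=
  2^-1 * \sum_(l < 2) invmx (G u) k l *
    (pd i (fun w => G w j l : R^o) u + pd j (fun w => G w i l : R^o) u
     - pd l (fun w => G w i j : R^o) u).

(* (nabla^2 F)_ij, taken componentwise for vector-valued F. *)
Definition hessian (R : realType) (G : 'rV[R]_2 -> 'M[R]_2)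
    (n : nat) (F : 'rV[R]_2 -> 'rV[R]_n) (i j : 'I_2) (u : 'rV[R]_2)
    : 'rV[R]_n :=
  pd i (pd j F) u - \sum_(k < 2) christoffel G k i j u *: pd k F u.

Definition metric_trace (R : realType) (n : nat) (G : 'M[R]_2)
    (B : 'I_2 -> 'I_2 -> 'rV[R]_n) : 'rV[R]_n :=
  \sum_(i < 2) \sum_(j < 2) invmx G i j *: B i j.

(* The value does not depend on the chart around p; [chart_at p] is used. *)
Definition laplacian (R : realType) (M : surface R)
    (g : riemannian_metric M) (n : nat) (f : M -> 'rV[R]_n) (p : M)
    : 'rV[R]_n :=
  let c := chart_at p in
  let u := coord c p in
  - metric_trace (gmat g c u)
      (fun i j => hessian (gmat g c) (f \o param c) i j u).

Definition laplace_map (R : realType) (M : surface R)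
    (g : riemannian_metric M) (x : M -> 'rV[R]_4) : M -> 'rV[R]_4 :=
  laplacian g x.

Definition induced_metric (R : realType) (n : nat) (F : 'rV[R]_2 -> 'rV[R]_n)
    (u : 'rV[R]_2) : 'M[R]_2 :=
  \matrix_(i, j) dot (pd i F u) (pd j F u).

(* Orthogonal projection of w onto the complement of the tangent plane of F. *)
Definition normal_part (R : realType) (n : nat) (F : 'rV[R]_2 -> 'rV[R]_n)
    (u : 'rV[R]_2) (w : 'rV[R]_n) : 'rV[R]_n :=
  w - metric_trace (induced_metric F u)
        (fun k l => dot w (pd l F u) *: pd k F u).

Definition hypersphere (R : realType) (n : nat) (a : 'rV[R]_n) (r : R)
    : set 'rV[R]_n := [set y | dot (y - a) (y - a) = r ^+ 2].

(* Orthogonal projection of w onto the tangent space at y of the hypersphere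
   of center a and radius r. *)
Definition sphere_tangent_part (R : realType) (n : nat) (a : 'rV[R]_n) (r : R)
    (y w : 'rV[R]_n) : 'rV[R]_n :=
  let nu := r^-1 *: (y - a) in w - dot w nu *: nu.

(* The Levi-Civita connection of the hypersphere is the tangential part of the
   flat one; the second fundamental form of F in the hypersphere is the part
   of the resulting derivative of pd j F normal to F. *)
Definition sphere_sff (R : realType) (n : nat) (a : 'rV[R]_n) (r : R)
    (F : 'rV[R]_2 -> 'rV[R]_n) (u : 'rV[R]_2) (i j : 'I_2) : 'rV[R]_n :=
  normal_part F u (sphere_tangent_part a r (F u) (pd i (pd j F) u)).

Definition sphere_mean_curvature (R : realType) (n : nat) (a : 'rV[R]_n)
    (r : R) (F : 'rV[R]_2 -> 'rV[R]_n) (u : 'rV[R]_2) : 'rV[R]_n :=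
  2^-1 *: metric_trace (induced_metric F u) (sphere_sff a r F u).

Definition minimal_in_hypersphere (R : realType) (M : surface R) (n : nat)
    (f : M -> 'rV[R]_n) (a : 'rV[R]_n) (r : R) : Prop :=
  [/\ 0 < r,
      immersion f,
      (forall p, hypersphere a r (f p)) &
      forall c p, atlas c -> dom c p ->
        sphere_mean_curvature a r (f \o param c) (coord c p) = 0].

(* Main.v *)
Require Import Defs.
From mathcomp Require Import all_boot all_order all_algebra.
From mathcomp Require Import all_classical all_reals all_analysis.
From mathcomp Require Import ring lra.
Import Order.TTheory GRing.Theory Num.Theory numFieldNormedType.Exports.

Set Implicit Arguments.
Unset Strict Implicit.
Unset Printing Implicit Defensive.

Local Open Scope classical_set_scope.
Local Open Scope ring_scope.

(* L = -2H is normal to M.  If L(M) is minimal in the sphere |y| = r, then the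
   Laplacian of L is proportional to L, because conformal changes of the metric
   rescale the Laplacian of a surface.  Put b = <L, h>; its trace is -r^2, and the
   tangential part of dL is -b.  Differentiating <L, h> and using the Laplacian of L,
   one finds that, for a unit vector n normal to M and L, the trace-free form
   <n, h> kills the vector dual to the one-form gamma = <n, dL>.  Hence
   <n, h> = 0 wherever gamma <> 0; there the Codazzi equation makes b (x) gamma
   symmetric, and dL kills a nonzero vector, which is absurd.  So gamma = 0
   everywhere, conformality forces b to be -(r^2/2) g, and dL = (r^2/2) dx:
   L and x differ by a homothety.  Conversely, if x is minimal in the sphere of
   center a and radius r, taking the trace of <x - a, h> = -g gives
   L = (2/r^2)(x - a). *)

(** * The Euclidean inner product and the symmetry of second derivatives *)

(** Two obstacles shape the argument. [laplacian] is evaluated at each point in that point's own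
    chart, so its formula cannot be handled in one fixed chart. It is replaced by a description
    valid in every chart: [L p] is normal, and its product with a normal vector [v] is minus the
    metric trace of [<v, second derivatives of x>]. All tangential terms, the Christoffel symbols
    included, drop out. Minimality in a sphere likewise becomes membership of that trace in the span
    of the position vector and the tangent plane. Second, [conformal] gives a factor with no
    regularity, so it is eliminated by cross-multiplication before differentiating. Instead of a
    chosen unit normal, the proof works with the normal part of [dL] multiplied by the determinant
    of the metric, an expression polynomial in derivatives of [x] and [L]. Smoothness of [L] is part
    of its minimality in one direction; in the other it comes from the explicit homothety.
    Conformality alone would still allow opposite eigenvalues of [b]; its nonzero trace excludes
    them. *)

Section Dot.
Variables (R : realType) (n : nat).
Implicit Types (u v w : 'rV[R]_n) (k : R).

Lemma dotC u v : dot u v = dot v u.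
Proof. by apply: eq_bigr => i _; rewrite mulrC. Qed.

Lemma dotDl u v w : dot (u + v) w = dot u w + dot v w.
Proof. by rewrite -big_split; apply: eq_bigr => i _; rewrite mxE mulrDl. Qed.

Lemma dotDr u v w : dot w (u + v) = dot w u + dot w v.
Proof. by rewrite !(dotC w) dotDl. Qed.

Lemma dotZl k u v : dot (k *: u) v = k * dot u v.
Proof. by rewrite mulr_sumr; apply: eq_bigr => i _; rewrite mxE mulrA. Qed.

Lemma dotZr k u v : dot u (k *: v) = k * dot u v.
Proof. by rewrite !(dotC u) dotZl. Qed.

Lemma dotNl u v : dot (- u) v = - dot u v.
Proof. by rewrite -scaleN1r dotZl mulN1r. Qed.

Lemma dotNr u v : dot u (- v) = - dot u v.
Proof. by rewrite !(dotC u) dotNl. Qed.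

Lemma dotBl u v w : dot (u - v) w = dot u w - dot v w.
Proof. by rewrite dotDl dotNl. Qed.

Lemma dotBr u v w : dot w (u - v) = dot w u - dot w v.
Proof. by rewrite dotDr dotNr. Qed.

Lemma dot0l u : dot 0 u = 0.
Proof. by rewrite -(scale0r u) dotZl mul0r. Qed.

Lemma dot0r u : dot u 0 = 0.
Proof. by rewrite dotC dot0l. Qed.

Lemma dot_ge0 u : 0 <= dot u u.
Proof. by apply: sumr_ge0 => i _; rewrite -expr2 sqr_ge0. Qed.

Lemma dot_eq0 u : (dot u u == 0) = (u == 0).
Proof.
apply/eqP/eqP => [u0|->]; last by rewrite dot0l.
have u2 i : 0 <= u 0 i * u 0 i by rewrite -expr2 sqr_ge0.
apply/rowP => i; rewrite mxE.
have /eqP := psumr_eq0P (fun j _ => u2 j) u0 (i := i) isT.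
by rewrite mulf_eq0 orbb => /eqP.
Qed.

Lemma dot_gt0 u : (0 < dot u u) = (u != 0).
Proof. by rewrite lt0r dot_eq0 dot_ge0 andbT. Qed.

End Dot.

Definition dotE := (dotDl, dotDr, dotBl, dotBr, dotNl, dotNr, dotZl, dotZr,
                    dot0l, dot0r).

Section Calculus.
Variables (R : realType) (V : normedModType R).

Lemma is_derive_coord n (f : V -> 'rV[R]_n) u v df i :
  is_derive u v f df -> is_derive u v (fun w => f w 0 i) (df 0 i).
Proof.
move=> [fuv <-]; apply: DeriveDef; first exact: (derivable_mxP _ _ _).1.
by rewrite derive_mx // mxE.
Qed.

Lemma is_derive_dot n (f g : V -> 'rV[R]_n) u v df dg :
  is_derive u v f df -> is_derive u v g dg ->
  is_derive u v (fun w => dot (f w) (g w)) (dot df (g u) + dot (f u) dg).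
Proof.
move=> dfu dgu.
have -> : (fun w => dot (f w) (g w)) =
    \sum_(i < n) ((fun w => f w 0 i) * (fun w => g w 0 i)).
  by apply/funext => w; rewrite /dot fct_sumE.
apply: is_derive_eq.
  by apply: is_derive_sum => i; apply: is_deriveM; apply: is_derive_coord.
rewrite -big_split; apply: eq_bigr => i _ /=.
by rewrite addrC /GRing.scale /=; congr (_ + _); rewrite mulrC.
Qed.

Lemma is_derive_line (f : V -> R) u v s d :
  is_derive (u + s *: v) v f d ->
  is_derive s (1 : R) (fun t => f (u + t *: v)) d.
Proof.
have E : (fun h : R => h^-1 *: ((f \o shift (u + s *: v)) (h *: v) -
      f (u + s *: v))) =
    (fun h : R => h^-1 *: (((fun t => f (u + t *: v)) \o shift s) (h *: 1) -
      f (u + s *: v))).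
  apply/funext => h /=; congr (_ *: (f _ - _)).
  by rewrite addrCA scalerDl [h *: 1]mulr1.
by move=> [fd <-]; apply: DeriveDef; rewrite /derivable /derive -E.
Qed.

Lemma mvt_line (f df : V -> R) u v (h : R) : 0 < h ->
  (forall s, 0 <= s <= h -> is_derive (u + s *: v) v f (df (u + s *: v))) ->
  exists2 s, 0 < s < h & f (u + h *: v) - f u = h * df (u + s *: v).
Proof.
move=> h0 fd.
have fd' s : 0 <= s <= h ->
    is_derive s (1 : R) (fun t => f (u + t *: v)) (df (u + s *: v)).
  by move=> /fd; exact: is_derive_line.
have [||s] := @MVT R (fun t => f (u + t *: v)) (fun s => df (u + s *: v)) 0 h h0.
- by move=> s; rewrite in_itv /= => /andP[s0 sh]; apply: fd'; rewrite !ltW.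
- apply: continuous_in_subspaceT => s; rewrite inE /= in_itv /= => sh.
  exact/differentiable_continuous/derivable1_diffP/(@ex_derive _ _ _ _ _ _ _ (fd' _ sh)).
- rewrite in_itv /= => sh.
  by rewrite scale0r addr0 subr0 mulrC; exists s.
Qed.

(** The mean value theorem is used twice: along [v] for [z |-> f (z + h *: w) - f z], then along [w]
    for [fv]. *)
Lemma second_difference (f fv fvw : V -> R) u v w (h : R) : 0 < h ->
  (forall s t, 0 <= s <= h -> 0 <= t <= h ->
     let z := u + s *: v + t *: w in
     is_derive z v f (fv z) /\ is_derive z w fv (fvw z)) ->
  exists s t, [/\ 0 < s < h, 0 < t < h &
    f (u + h *: v + h *: w) - f (u + h *: v) - f (u + h *: w) + f u =
    h ^+ 2 * fvw (u + s *: v + t *: w)].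
Proof.
move=> h0 fd.
have h0h : 0 <= h <= h by rewrite ?lexx ?ltW ?lexx.
have h00 : 0 <= (0 : R) <= h by apply/andP; split; [exact: lexx | exact: ltW].
have [|s sh E1] := @mvt_line (fun z => f (z + h *: w) - f z)
   (fun z => fv (z + h *: w) - fv z) u v h h0.
  move=> s sh; apply: is_deriveB.
    have [+ _] := fd s h sh h0h => /=; set z := u + s *: v => d.
    have E : (fun k : R => k^-1 *: ((f \o shift (z + h *: w)) (k *: v) -
        f (z + h *: w))) =
      (fun k : R => k^-1 *: (((fun z => f (z + h *: w)) \o shift z) (k *: v) -
        f (z + h *: w))).
      by apply/funext => k /=; rewrite addrA.
    by case: d => d1 <-; apply: DeriveDef; rewrite /derivable /derive -E.
  by have [+ _] := fd s 0 sh h00; rewrite scale0r addr0.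
have sh' : 0 <= s <= h by case/andP: sh => ? ?; rewrite !ltW.
have [|t th E2] := @mvt_line fv fvw (u + s *: v) w h h0.
  by move=> t th; have [] := fd s t sh' th.
exists s, t; split => //.
by rewrite expr2 -mulrA -E2 -E1; ring.
Qed.

(** The second difference of [f] is symmetric in [v] and [w], so [fvw] and [fwv] agree at two points
    near [u]; continuity carries this to [u]. *)
Lemma schwarz_scalar (f fv fw fvw fwv : V -> R) (U : set V) u v w :
  open U -> U u ->
  (forall z, U z -> is_derive z v f (fv z)) ->
  (forall z, U z -> is_derive z w f (fw z)) ->
  (forall z, U z -> is_derive z w fv (fvw z)) ->
  (forall z, U z -> is_derive z v fw (fwv z)) ->
  {for u, continuous fvw} -> {for u, continuous fwv} ->
  fvw u = fwv u.
Proof.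
move=> oU Uu dv dw dvw dwv cvw cwv.
apply/eqP; rewrite -subr_eq0 -normr_le0; apply/ler_addgt0Pl => e e0.
rewrite addr0.
have e2 : 0 < e / 2 by rewrite divr_gt0.
have : \forall z \near u, U z /\ `|fvw u - fvw z| < e / 2 /\ `|fwv u - fwv z| < e / 2.
  apply: filterI; first exact: open_nbhs_nbhs.
  by apply: filterI; [move/cvgrPdist_lt: cvw; apply | move/cvgrPdist_lt: cwv; apply].
move=> /nbhs_normP[d /= d0 near_d].
pose K := `|v| + `|w| + 1.
have K0 : 0 < K by rewrite /K; have := normr_ge0 v; have := normr_ge0 w; lra.
pose h := d / (K * 2).
have h0 : 0 < h by rewrite divr_gt0 // mulr_gt0.
have hd s t : 0 <= s <= h -> 0 <= t <= h -> ball_ Num.norm u d (u + s *: v + t *: w).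
  move=> /andP[s0 sh] /andP[t0 th]; rewrite /ball_ /= -addrA opprD addrA subrr add0r normrN.
  apply: le_lt_trans (ler_normD _ _) _; rewrite !normrZ !ger0_norm //.
  have : h * K = d / 2 by rewrite /h; field; rewrite gt_eqF.
  have := ler_wpM2r (normr_ge0 v) sh; have := ler_wpM2r (normr_ge0 w) th.
  by rewrite /K; nra.
have wid a : 0 < a < h -> 0 <= a <= h by case/andP => ? ?; rewrite !ltW.
have [s1 [t1 [/wid s1h /wid t1h E1]]] : exists s t, [/\ 0 < s < h, 0 < t < h &
    f (u + h *: v + h *: w) - f (u + h *: v) - f (u + h *: w) + f u =
    h ^+ 2 * fvw (u + s *: v + t *: w)].
  apply: (second_difference (fv := fv)) => // s t sh th z.
  by have [Uz _] := near_d _ (hd _ _ sh th); split; [exact: dv | exact: dvw].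
have [s2 [t2 [/wid s2h /wid t2h E2]]] : exists s t, [/\ 0 < s < h, 0 < t < h &
    f (u + h *: w + h *: v) - f (u + h *: w) - f (u + h *: v) + f u =
    h ^+ 2 * fwv (u + s *: w + t *: v)].
  apply: (second_difference (fv := fw)) => // s t sh th z.
  have [] := near_d _ (hd _ _ th sh); rewrite addrAC => Uz _.
  by split; [exact: dw | exact: dwv].
have [_ [n1 _]] := near_d _ (hd _ _ s1h t1h).
have [_ [_ ]] := near_d _ (hd _ _ t2h s2h); rewrite addrAC => n2.
have E : fvw (u + s1 *: v + t1 *: w) = fwv (u + s2 *: w + t2 *: v).
  apply: (mulfI (lt0r_neq0 (exprn_gt0 2 h0))); rewrite -E1 -E2.
  by rewrite (addrAC u); ring.
rewrite -E in n2.
rewrite (le_trans (ler_distD (fvw (u + s1 *: v + t1 *: w)) _ _)) //.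
by rewrite (distrC _ (fwv u)) ltW // [e]splitr ltrD.
Qed.

End Calculus.

Section Calculus2.
Variables (R : realType) (V : normedModType R).

Lemma is_derive_rV n (f : V -> 'rV[R]_n) u v (df : 'rV[R]_n) :
  (forall i, is_derive u v (fun w => f w 0 i) (df 0 i)) -> is_derive u v f df.
Proof.
move=> fd.
have D : derivable f u v by apply/derivable_mxP => i j; rewrite ord1; case: (fd j).
apply: DeriveDef => //; rewrite derive_mx //.
by apply/rowP => j; rewrite mxE; case: (fd j).
Qed.

Lemma is_derive_scale n (k : V -> R) (f : V -> 'rV[R]_n) u v dk df :
  is_derive u v k dk -> is_derive u v f df ->
  is_derive u v (fun w => k w *: f w) (dk *: f u + k u *: df).
Proof.
move=> kd fd; apply: is_derive_rV => i.
have -> : (fun w => (k w *: f w) 0 i) = k * (fun w => f w 0 i).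
  by apply/funext => w; rewrite mxE.
apply: is_derive_eq; first by apply: is_deriveM; exact: is_derive_coord.
by rewrite !mxE addrC /GRing.scale /=; congr (_ + _); rewrite mulrC.
Qed.

Lemma is_derive_mul (f g : V -> R) u v df dg :
  is_derive u v f df -> is_derive u v g dg ->
  is_derive u v (fun w => f w * g w) (df * g u + f u * dg).
Proof.
move=> fd gd; rewrite (_ : (fun w => _) = f * g) //.
apply: is_derive_eq (is_deriveM fd gd) _.
by rewrite addrC /GRing.scale /=; congr (_ + _); rewrite mulrC.
Qed.

Lemma is_derive_sqr (f : V -> R) u v df : is_derive u v f df ->
  is_derive u v (fun w => f w ^+ 2) (df * f u + f u * df).
Proof. by move=> fu; exact: (is_derive_mul fu fu). Qed.

Lemma is_derive_cmul (k : R) (f : V -> R) u v df :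
  is_derive u v f df -> is_derive u v (fun w => k * f w) (k * df).
Proof. exact: is_deriveZ. Qed.

Lemma is_derive_sub (f g : V -> R) u v df dg :
  is_derive u v f df -> is_derive u v g dg ->
  is_derive u v (fun w => f w - g w) (df - dg).
Proof. exact: is_deriveB. Qed.

Lemma is_derive_add (f g : V -> R) u v df dg :
  is_derive u v f df -> is_derive u v g dg ->
  is_derive u v (fun w => f w + g w) (df + dg).
Proof. exact: is_deriveD. Qed.

Lemma is_derive_unique_on (W : normedModType R) (U : set V) (f g : V -> W) u v a b :
  open U -> U u -> (forall z, U z -> f z = g z) ->
  is_derive u v f a -> is_derive u v g b -> a = b.
Proof.
move=> oU Uu fg [_ <-] [_ <-]; apply: near_eq_derive.
by apply: filterS (open_nbhs_nbhs (conj oU Uu)) => z; exact: fg.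
Qed.

Lemma smooth_is_derive (W : normedModType R) (U : set V) (f : V -> W) u v :
  smooth_on U f -> U u -> is_derive u v f ('D_v f u).
Proof. by move=> /(_ 1%N)[fd _] /fd /diff_derivable fu; apply: DeriveDef. Qed.

Lemma smooth_derive (W : normedModType R) (U : set V) (f : V -> W) v :
  smooth_on U f -> smooth_on U ('D_v f).
Proof. by move=> fs k; have [_] := fs k.+1; apply. Qed.

Lemma schwarz n (U : set V) (f : V -> 'rV[R]_n) u v w :
  open U -> smooth_on U f -> U u -> 'D_w ('D_v f) u = 'D_v ('D_w f) u.
Proof.
move=> oU fs Uu; apply/rowP => i.
have ci (h : V -> 'rV[R]_n) : smooth_on U h -> {for u, continuous (fun z => h z 0 i)}.
  move=> /(_ 0%N) /(_ u Uu) hu.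
  exact: (continuous_comp hu (@coord_continuous _ _ _ _ _ _)).
apply: (@schwarz_scalar _ _ (fun z => f z 0 i) (fun z => 'D_v f z 0 i)
   (fun z => 'D_w f z 0 i) (fun z => 'D_w ('D_v f) z 0 i)
   (fun z => 'D_v ('D_w f) z 0 i) U u v w oU Uu) => [z Uz|z Uz|z Uz|z Uz||];
  try by apply: is_derive_coord; apply: smooth_is_derive Uz; do ?apply: smooth_derive.
- by apply: ci; do 2!apply: smooth_derive.
- by apply: ci; do 2!apply: smooth_derive.
Qed.

End Calculus2.

(** * Two by two matrices and orthogonality in four dimensions *)

Section TwoByTwo.
Variable R : realType.

Lemma ord2P (P : 'I_2 -> Prop) : P 0 -> P 1 -> forall i, P i.
Proof.
move=> P0 P1 [[|[|//]] lti]; first by rewrite (_ : Ordinal lti = 0) //; exact: val_inj.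
by rewrite (_ : Ordinal lti = 1) //; exact: val_inj.
Qed.

Lemma sum2 (Z : nmodType) (f : 'I_2 -> Z) : \sum_(i < 2) f i = f 0 + f 1.
Proof.
by rewrite !big_ord_recl big_ord0 addr0; congr (f _ + f _); exact: val_inj.
Qed.

Definition det2 (G : 'M[R]_2) : R := G 0 0 * G 1 1 - G 0 1 * G 1 0.

(* [det2 G] times [metric_trace G B], without division. *)
Definition cotrace (W : lmodType R) (G : 'M[R]_2) (B : 'I_2 -> 'I_2 -> W) : W :=
  G 1 1 *: B 0 0 - G 0 1 *: B 0 1 - G 1 0 *: B 1 0 + G 0 0 *: B 1 1.

Lemma invmx2 (G : 'M[R]_2) : det2 G != 0 ->
  [/\ invmx G 0 0 = (det2 G)^-1 * G 1 1, invmx G 0 1 = - ((det2 G)^-1 * G 0 1),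
      invmx G 1 0 = - ((det2 G)^-1 * G 1 0) & invmx G 1 1 = (det2 G)^-1 * G 0 0].
Proof.
move=> d0; pose N : 'M[R]_2 := \matrix_(i, j)
  if i == 0 then if j == 0 then (det2 G)^-1 * G 1 1 else - ((det2 G)^-1 * G 0 1)
  else if j == 0 then - ((det2 G)^-1 * G 1 0) else (det2 G)^-1 * G 0 0.
have NG : N *m G = 1%:M.
  apply/matrixP => i j; rewrite !mxE sum2 !mxE /=.
  by elim/ord2P: i; elim/ord2P: j; rewrite /= ?mulr1n ?mulr0n /det2; field.
have [_ Gu] := mulmx1_unit NG.
have -> : invmx G = N by rewrite -[LHS]mul1mx -NG mulmxK.
by rewrite !mxE.
Qed.

Lemma metric_traceE n (G : 'M[R]_2) (B : 'I_2 -> 'I_2 -> 'rV[R]_n) :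
  det2 G != 0 -> metric_trace G B = (det2 G)^-1 *: cotrace G B.
Proof.
move=> /invmx2[E00 E01 E10 E11].
rewrite /metric_trace sum2 !sum2 E00 E01 E10 E11 /cotrace.
by rewrite !scalerDr !scalerN !scalerA !scaleNr !addrA.
Qed.

End TwoByTwo.

(** Otherwise five independent vectors would live in dimension four: in a linear relation,
    orthogonality kills the coefficients of [w], [n] and [l], and the Gram determinant those of [f0]
    and [f1]. *)
Lemma orth4_eq0 (R : realType) (f0 f1 l n w : 'rV[R]_4) :
  dot f0 f0 * dot f1 f1 - dot f0 f1 ^+ 2 != 0 -> l != 0 -> n != 0 ->
  dot l f0 = 0 -> dot l f1 = 0 ->
  dot n f0 = 0 -> dot n f1 = 0 -> dot n l = 0 ->
  dot w f0 = 0 -> dot w f1 = 0 -> dot w l = 0 -> dot w n = 0 -> w = 0.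
Proof.
move=> d0 l0 n0 lf0 lf1 nf0 nf1 nl wf0 wf1 wl wn; apply/eqP.
rewrite -dot_eq0; apply/negP => /negP w0.
rewrite -dot_eq0 in l0; rewrite -dot_eq0 in n0.
pose A : 'M[R]_(5, 4) := \matrix_(i < 5) nth 0 [:: f0; f1; l; n; w] i.
have K0 : kermx A != 0.
  rewrite -mxrank_eq0 mxrank_ker subn_eq0 -ltnNge.
  by apply: leq_ltn_trans (rank_leq_col _) _.
pose v := nz_row (kermx A).
have v0 : v != 0 by rewrite nz_row_eq0.
have : v *m A = 0 by apply/sub_kermxP; exact: nz_row_sub.
rewrite mulmx_sum_row !big_ord_recl big_ord0 !rowK /= addr0.
set a := v 0 _; set b := v 0 _; set c := v 0 _; set e := v 0 _; set k := v 0 _ => E.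
have dE z : dot (a *: f0 + (b *: f1 + (c *: l + (e *: n + k *: w)))) z = 0.
  by rewrite E dot0l.
have k0 : k = 0.
  have /eqP := dE w; rewrite !dotE !(dotC _ w) wf0 wf1 wl wn !mulr0 !add0r.
  by rewrite mulf_eq0 (negPf w0) orbF => /eqP.
have e0 : e = 0.
  have /eqP := dE n; rewrite !dotE !(dotC _ n) nf0 nf1 nl (dotC n w) wn !mulr0 !add0r addr0.
  by rewrite mulf_eq0 (negPf n0) orbF => /eqP.
have c0 : c = 0.
  have /eqP := dE l; rewrite !dotE !(dotC _ l) lf0 lf1 (dotC l n) nl (dotC l w) wl.
  by rewrite !mulr0 !add0r !addr0 mulf_eq0 (negPf l0) orbF => /eqP.
have := dE f0; have := dE f1.
rewrite !dotE lf0 lf1 nf0 nf1 wf0 wf1 !mulr0 !addr0 (dotC f1 f0) => E1 E0.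
have a0 : a = 0.
  apply: (mulIf d0); rewrite mul0r.
  transitivity (dot f1 f1 * (a * dot f0 f0 + b * dot f0 f1)
     - dot f0 f1 * (a * dot f0 f1 + b * dot f1 f1)); first by ring.
  by rewrite E1 E0 !mulr0 subrr.
have b0 : b = 0.
  apply: (mulIf d0); rewrite mul0r.
  transitivity (dot f0 f0 * (a * dot f0 f1 + b * dot f1 f1)
     - dot f0 f1 * (a * dot f0 f0 + b * dot f0 f1)); first by ring.
  by rewrite E1 E0 !mulr0 subrr.
case/negP: v0; apply/eqP/rowP => i; rewrite [RHS]mxE.
case: i => [[|[|[|[|[|//]]]]] lti]; [rewrite -a0|rewrite -b0|rewrite -c0|rewrite -e0|rewrite -k0];
  by congr (v _ _); exact: val_inj.
Qed.

(** * Conformal normal fields in coordinates *)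

Lemma posdef2 (R : realType) (g00 g01 g11 y0 y1 : R) :
  0 < g00 -> 0 < g00 * g11 - g01 ^+ 2 -> (y0 != 0) || (y1 != 0) ->
  0 < g00 * y0 ^+ 2 + 2 * g01 * y0 * y1 + g11 * y1 ^+ 2.
Proof.
move=> p0 d0 y; rewrite -(pmulr_rgt0 _ p0).
have -> : g00 * (g00 * y0 ^+ 2 + 2 * g01 * y0 * y1 + g11 * y1 ^+ 2) =
  (g00 * y0 + g01 * y1) ^+ 2 + (g00 * g11 - g01 ^+ 2) * y1 ^+ 2 by ring.
have [y10|y10] := eqVneq y1 0.
  move: y; rewrite y10 eqxx orbF expr0n mulr0 mulr0 !addr0 => y0n.
  by rewrite exprn_even_gt0 //= mulf_neq0 // gt_eqF.
by rewrite ltr_wpDl ?sqr_ge0 // mulr_gt0 // exprn_even_gt0.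
Qed.

(** A symmetric form with zero trace has opposite eigenvalues relative to [g], so a nontrivial
    kernel forces it to vanish. Explicitly, [g(y, y)] times [p00] or [p11] is a combination of the
    hypotheses. *)
Lemma tracefree_ker_eq0 (R : realType) (g00 g01 g11 y0 y1 p00 p01 p11 : R) :
  0 < g00 -> 0 < g00 * g11 - g01 ^+ 2 -> (y0 != 0) || (y1 != 0) ->
  g11 * p00 - 2 * g01 * p01 + g00 * p11 = 0 ->
  y0 * p00 + y1 * p01 = 0 -> y0 * p01 + y1 * p11 = 0 ->
  [/\ p00 = 0, p01 = 0 & p11 = 0].
Proof.
move=> p0 d0 y t k0 k1; have q0 := lt0r_neq0 (posdef2 p0 d0 y).
have p00E : p00 = 0.
  apply: (mulIf q0); rewrite mul0r.
  transitivity (y1 ^+ 2 * (g11 * p00 - 2 * g01 * p01 + g00 * p11)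
    + (2 * g01 * y1 + g00 * y0) * (y0 * p00 + y1 * p01)
    - g00 * y1 * (y0 * p01 + y1 * p11)); first by ring.
  by rewrite t k0 k1 !mulr0 addr0 subr0.
have p11E : p11 = 0.
  apply: (mulIf q0); rewrite mul0r.
  transitivity (y0 ^+ 2 * (g11 * p00 - 2 * g01 * p01 + g00 * p11)
    + (2 * g01 * y0 + g11 * y1) * (y0 * p01 + y1 * p11)
    - g11 * y0 * (y0 * p00 + y1 * p01)); first by ring.
  by rewrite t k0 k1 !mulr0 addr0 subr0.
split=> //; move: k0 k1; rewrite p00E p11E !mulr0 add0r addr0 => k0 k1.
by case/orP: y => yn; apply: (mulfI yn); rewrite mulr0.
Qed.

(** With subscripts for partial derivatives and [m] fixed, [a], [p], [q], [l], [f] stand for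
    [<L_i, F_mj>], [<L_m, F_ij>], [<L, F_mij>], [<L_ij, F_m>], [<F_mi, F_j>]. The last hypothesis is
    the derivative along [m] of the trace of [b]. Eliminating [q] makes the traces of [l] and [p],
    both [K], cancel, and only the trace of [a] is left. *)
Lemma trace_normal_derivative (R : realType) (g00 g01 g11 b00 b01 b11 r2 K
    a00 a01 a10 a11 p00 p01 p11 q00 q01 q11 l00 l01 l11 f00 f01 f10 f11 : R) :
  let d := g00 * g11 - g01 ^+ 2 in
  g11 * b00 - 2 * (g01 * b01) + g00 * b11 = - r2 * (g00 * g11 - g01 * g01) ->
  l00 + a00 = - (a00 + q00) -> l01 + a10 = - (a01 + q01) ->
  l11 + a11 = - (a11 + q11) ->
  g11 * l00 - 2 * g01 * l01 + g00 * l11 = K ->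
  g11 * p00 - 2 * g01 * p01 + g00 * p11 = K ->
  ((f11 + f11) * b00 + g11 * (p00 + q00))
  - 2 * ((f01 + f10) * b01 + g01 * (p01 + q01))
  + ((f00 + f00) * b11 + g00 * (p11 + q11))
  = - (((f00 + f00) * g11 + g00 * (f11 + f11) - 2 * ((f01 + f10) * g01)) * r2) ->
  g11 * (d * a00 + (b00 * g11 - b01 * g01) * f00 + (b01 * g00 - b00 * g01) * f01)
  - g01 * (d * a01 + (b00 * g11 - b01 * g01) * f10 + (b01 * g00 - b00 * g01) * f11
     + (d * a10 + (b01 * g11 - b11 * g01) * f00 + (b11 * g00 - b01 * g01) * f01))
  + g00 * (d * a11 + (b01 * g11 - b11 * g01) * f10 + (b11 * g00 - b01 * g01) * f11)
  = 0.
Proof.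
move=> d Tb E00 E01 E11 HL HF Ed.
pose pd := (f00 + f00) * g11 + g00 * (f11 + f11) - 2 * ((f01 + f10) * g01).
have A : 2 * (g11 * a00 - g01 * (a01 + a10) + g00 * a11) =
  (f11 + f11) * b00 - 2 * ((f01 + f10) * b01) + (f00 + f00) * b11 + pd * r2.
  have Q00 : q00 = - (l00 + a00 + a00) by lra.
  have Q01 : q01 = - (l01 + a10 + a01) by lra.
  have Q11 : q11 = - (l11 + a11 + a11) by lra.
  by move: Ed; rewrite Q00 Q01 Q11 /pd => Ed; lra.
have dA : 2 * d * (g11 * a00 - g01 * (a01 + a10) + g00 * a11) =
  d * ((f11 + f11) * b00 - 2 * ((f01 + f10) * b01) + (f00 + f00) * b11)
  - pd * (g11 * b00 - 2 * (g01 * b01) + g00 * b11).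
  by rewrite -mulrA (mulrCA 2) A Tb /d; ring.
apply: (mulfI (_ : (2 : R) != 0)); first by rewrite pnatr_eq0.
transitivity (2 * d * (g11 * a00 - g01 * (a01 + a10) + g00 * a11) -
  (d * ((f11 + f11) * b00 - 2 * ((f01 + f10) * b01) + (f00 + f00) * b11)
  - pd * (g11 * b00 - 2 * (g01 * b01) + g00 * b11))); last by rewrite dA subrr mulr0.
by rewrite /pd /d; ring.
Qed.

Lemma cramer2 (R : realType) (g00 g01 g11 x y : R) :
  let d := g00 * g11 - g01 ^+ 2 in d != 0 ->
  (x * g11 - y * g01) / d * g00 + (y * g00 - x * g01) / d * g01 = x /\
  (x * g11 - y * g01) / d * g01 + (y * g00 - x * g01) / d * g11 = y.
Proof.
by move=> d d0; split; apply: (mulIf d0);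
  rewrite mulrDl !(mulrAC _ d^-1) !mulfK // /d; ring.
Qed.

Section ConformalNormal.
(* [F1], [F2], [F3] stand for the partial derivatives, in the directions [e], of an
   immersion F, and [L1], [L2] for those of [L]. *)
Variables (R : realType) (V : normedModType R) (U : set V) (e : 'I_2 -> V).
Variables (L : V -> 'rV[R]_4) (F1 L1 : 'I_2 -> V -> 'rV[R]_4).
Variables (F2 L2 : 'I_2 -> 'I_2 -> V -> 'rV[R]_4).
Variables (F3 : 'I_2 -> 'I_2 -> 'I_2 -> V -> 'rV[R]_4).
Variable r : R.
Hypotheses (oU : open U) (r0 : 0 < r).
Hypothesis dF1 : forall i j u, U u -> is_derive u (e i) (F1 j) (F2 i j u).
Hypothesis dF2 : forall i j k u, U u -> is_derive u (e i) (F2 j k) (F3 i j k u).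
Hypothesis dL : forall i u, U u -> is_derive u (e i) L (L1 i u).
Hypothesis dL1 : forall i j u, U u -> is_derive u (e i) (L1 j) (L2 i j u).
Hypothesis F2C : forall i j u, U u -> F2 i j u = F2 j i u.
Hypothesis L2C : forall i j u, U u -> L2 i j u = L2 j i u.
Hypothesis F3C : forall i j k u, U u -> F3 i j k u = F3 j i k u.

Local Notation gm i j u := (dot (F1 i u) (F1 j u)).
Local Notation det u := (gm 0 0 u * gm 1 1 u - gm 0 1 u ^+ 2).
Local Notation b i j u := (dot (L u) (F2 i j u)).

Hypothesis LF : forall i u, U u -> dot (L u) (F1 i u) = 0.
Hypothesis LL : forall u, U u -> dot (L u) (L u) = r ^+ 2.
Hypothesis conf : forall u, U u -> exists2 s, 0 < s &
  forall i j, dot (L1 i u) (L1 j u) = s * gm i j u.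
Hypothesis g00_gt0 : forall u, U u -> 0 < gm 0 0 u.
Hypothesis det_gt0 : forall u, U u -> 0 < det u.
(** Unspecified tangential coefficients in [TF] and [TL] absorb the Christoffel symbols. The trace
    in [TL] is taken in the metric of [F], proportional to that of [L]. *)
Hypothesis TF : forall u, U u -> exists t0 t1,
  gm 1 1 u *: F2 0 0 u - (2 * gm 0 1 u) *: F2 0 1 u + gm 0 0 u *: F2 1 1 u
  = - (det u *: L u) + t0 *: F1 0 u + t1 *: F1 1 u.
Hypothesis TL : forall u, U u -> exists mu t0 t1,
  gm 1 1 u *: L2 0 0 u - (2 * gm 0 1 u) *: L2 0 1 u + gm 0 0 u *: L2 1 1 u
  = mu *: L u + t0 *: L1 0 u + t1 *: L1 1 u.

Let dgm i j k u : U u -> is_derive u (e k) (fun u => gm i j u)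
  (dot (F2 k i u) (F1 j u) + dot (F1 i u) (F2 k j u)).
Proof. by move=> Uu; apply: is_derive_dot; exact: dF1. Qed.

Let db i j k u : U u -> is_derive u (e k) (fun u => b i j u)
  (dot (L1 k u) (F2 i j u) + dot (L u) (F3 k i j u)).
Proof. by move=> Uu; apply: is_derive_dot; [exact: dL|exact: dF2]. Qed.

Let F3Cr i j k u : U u -> F3 i j k u = F3 i k j u.
Proof.
move=> Uu.
exact: (is_derive_unique_on oU Uu (@F2C j k) (dF2 i j k Uu) (dF2 i k j Uu)).
Qed.

Let LiF i j u : U u -> dot (L1 i u) (F1 j u) = - b i j u.
Proof.
move=> Uu; apply/eqP; rewrite -addr_eq0; apply/eqP.
apply: (is_derive_unique_on (v := e i) (g := cst 0) oU Uu (@LF j)) _ (is_derive_cst _ _ _).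
by apply: is_derive_dot; [exact: dL|exact: dF1].
Qed.

Let LiL i u : U u -> dot (L1 i u) (L u) = 0.
Proof.
move=> Uu; suff : dot (L1 i u) (L u) + dot (L u) (L1 i u) = 0.
  by rewrite (dotC (L u)); lra.
apply: (is_derive_unique_on (v := e i) (g := cst (r ^+ 2)) oU Uu LL) _ (is_derive_cst _ _ _).
by apply: is_derive_dot; exact: dL.
Qed.

Let LijF k i j u : U u ->
  dot (L2 k i u) (F1 j u) + dot (L1 i u) (F2 k j u) =
  - (dot (L1 k u) (F2 i j u) + dot (L u) (F3 k i j u)).
Proof.
move=> Uu.
apply: (is_derive_unique_on (v := e k) (g := (fun u => - b i j u)) oU Uu (@LiF i j)) _ _; last first.
  by apply: is_deriveN; exact: db.
by apply: is_derive_dot; [exact: dL1|exact: dF1].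
Qed.

Let conf_derive u : U u -> exists s t0 t1, [/\ 0 < s,
  forall i j, dot (L1 i u) (L1 j u) = s * gm i j u &
  forall i j k, dot (L2 k i u) (L1 j u) + dot (L1 i u) (L2 k j u)
   = (if k == 0 then t0 else t1) * gm i j u +
     s * (dot (F2 k i u) (F1 j u) + dot (F1 i u) (F2 k j u))].
Proof.
move=> Uu; have [s s0 Es] := conf Uu.
pose pl i j k := dot (L2 k i u) (L1 j u) + dot (L1 i u) (L2 k j u).
pose pg i j k := dot (F2 k i u) (F1 j u) + dot (F1 i u) (F2 k j u).
pose t k := (pl 0 0 k - s * pg 0 0 k) / gm 0 0 u.
exists s, (t 0), (t 1); split => // i j k.
rewrite (_ : (if k == 0 then t 0 else t 1) = t k); last by elim/ord2P: k.
have gn0 := lt0r_neq0 (g00_gt0 Uu).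
have : pl i j k * gm 0 0 u + s * gm i j u * pg 0 0 k =
       pl 0 0 k * gm i j u + s * gm 0 0 u * pg i j k.
  rewrite -(Es i j) -(Es 0 0).
  have H z : U z -> dot (L1 i z) (L1 j z) * gm 0 0 z =
      dot (L1 0 z) (L1 0 z) * gm i j z.
    by move=> /conf[s' _ E]; rewrite (E i j) (E 0 0); ring.
  apply: (is_derive_unique_on (v := e k) oU Uu H).
    apply: is_derive_mul; last exact: dgm.
    by apply: is_derive_dot; exact: dL1.
  apply: is_derive_mul; last exact: dgm.
  by apply: is_derive_dot; exact: dL1.
rewrite -/(pl i j k) -/(pg i j k) => E; apply: (mulIf gn0).
have Et : t k * gm i j u * gm 0 0 u = (pl 0 0 k - s * pg 0 0 k) * gm i j u.
  by rewrite /t; field.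
by rewrite [RHS]mulrDl Et; lra.
Qed.

Let trace_dot u (B : 'I_2 -> 'I_2 -> 'rV[R]_4) w :
  dot (gm 1 1 u *: B 0 0 - (2 * gm 0 1 u) *: B 0 1 + gm 0 0 u *: B 1 1) w =
  gm 1 1 u * dot (B 0 0) w - 2 * gm 0 1 u * dot (B 0 1) w + gm 0 0 u * dot (B 1 1) w.
Proof. by rewrite !dotE. Qed.

(* The Laplacian of a conformally related metric on a surface has no first order
   correction, so both traces have the same tangential coefficients. *)
Let traces u : U u -> exists mu t0 t1,
  gm 1 1 u *: F2 0 0 u - (2 * gm 0 1 u) *: F2 0 1 u
    + gm 0 0 u *: F2 1 1 u
  = - (det u *: L u) + t0 *: F1 0 u + t1 *: F1 1 u /\
  gm 1 1 u *: L2 0 0 u - (2 * gm 0 1 u) *: L2 0 1 u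
    + gm 0 0 u *: L2 1 1 u
  = mu *: L u + t0 *: L1 0 u + t1 *: L1 1 u.
Proof.
move=> Uu; have [t0 [t1 ET]] := TF Uu; have [mu [s0 [s1 ES]]] := TL Uu.
exists mu, t0, t1; split => //.
have [s [k0 [k1 [s_gt0 El Ed]]]] := conf_derive Uu.
have Td (m : 'I_2) :
   gm 1 1 u * dot (L2 0 0 u) (L1 m u)
   - 2 * gm 0 1 u * dot (L2 0 1 u) (L1 m u)
   + gm 0 0 u * dot (L2 1 1 u) (L1 m u) =
   s * (gm 1 1 u * dot (F2 0 0 u) (F1 m u)
   - 2 * gm 0 1 u * dot (F2 0 1 u) (F1 m u)
   + gm 0 0 u * dot (F2 1 1 u) (F1 m u)).
  have := Ed 0 0 0; have := Ed 0 0 1; have := Ed 0 1 0; have := Ed 0 1 1.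
  have := Ed 1 1 0; have := Ed 1 1 1 => /=.
  rewrite !(@F2C 1 0) // !(@L2C 1 0) // !(dotC (L1 _ u) (L2 _ _ u)).
  rewrite !(dotC (F1 _ u) (F2 _ _ u)).
  set l000 := dot (L2 0 0 u) (L1 0 u).
  set l001 := dot (L2 0 0 u) (L1 1 u).
  set l010 := dot (L2 0 1 u) (L1 0 u).
  set l011 := dot (L2 0 1 u) (L1 1 u).
  set l110 := dot (L2 1 1 u) (L1 0 u).
  set l111 := dot (L2 1 1 u) (L1 1 u).
  set f000 := dot (F2 0 0 u) (F1 0 u).
  set f001 := dot (F2 0 0 u) (F1 1 u).
  set f010 := dot (F2 0 1 u) (F1 0 u).
  set f011 := dot (F2 0 1 u) (F1 1 u).
  set f110 := dot (F2 1 1 u) (F1 0 u).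
  set f111 := dot (F2 1 1 u) (F1 1 u).
  move=> E111 E110 E011 E010 E001 E000.
  (* These are the Christoffel symbols of the first kind of [s] times the metric, [k0] and [k1]
     acting as derivatives of [s]; their terms cancel in the trace below. *)
  have X000 : l000 = s * f000 + k0 * gm 0 0 u / 2 by lra.
  have X010 : l010 = s * f010 + k1 * gm 0 0 u / 2 by lra.
  have X011 : l011 = s * f011 + k0 * gm 1 1 u / 2 by lra.
  have X111 : l111 = s * f111 + k1 * gm 1 1 u / 2 by lra.
  have X001 : l001 = s * f001 + k0 * gm 0 1 u - k1 * gm 0 0 u / 2 by lra.
  have X110 : l110 = s * f110 + k1 * gm 0 1 u - k0 * gm 1 1 u / 2 by lra.
  elim/ord2P: m.
    by rewrite -/l000 -/l010 -/l110 -/f000 -/f010 -/f110 X000 X010 X110; field.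
  by rewrite -/l001 -/l011 -/l111 -/f001 -/f011 -/f111 X001 X011 X111; field.
have Q (m : 'I_2) : s0 * gm 0 m u + s1 * gm 1 m u = t0 * gm 0 m u + t1 * gm 1 m u.
  have := Td m.
  rewrite -(trace_dot u (fun i j => L2 i j u)) ES.
  rewrite -(trace_dot u (fun i j => F2 i j u)) ET.
  rewrite !dotE LF // (dotC (L u)) LiL // !El => H.
  by apply: (mulfI (lt0r_neq0 s_gt0)); lra.
have d0 := lt0r_neq0 (det_gt0 Uu).
have := Q 0; have := Q 1; rewrite (dotC (F1 1 u) (F1 0 u)) => Q1 Q0.
have -> : t0 = s0.
  apply: (mulIf d0); apply/eqP; rewrite -subr_eq0; apply/eqP.
  rewrite (_ : _ - _ = gm 1 1 u * (t0 * gm 0 0 u + t1 * gm 0 1 u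
    - (s0 * gm 0 0 u + s1 * gm 0 1 u))
    - gm 0 1 u * (t0 * gm 0 1 u + t1 * gm 1 1 u
    - (s0 * gm 0 1 u + s1 * gm 1 1 u))); last by ring.
  by rewrite Q0 Q1 !subrr !mulr0 subrr.
have -> : t1 = s1.
  apply: (mulIf d0); apply/eqP; rewrite -subr_eq0; apply/eqP.
  rewrite (_ : _ - _ = gm 0 0 u * (t0 * gm 0 1 u + t1 * gm 1 1 u
    - (s0 * gm 0 1 u + s1 * gm 1 1 u))
    - gm 0 1 u * (t0 * gm 0 0 u + t1 * gm 0 1 u
    - (s0 * gm 0 0 u + s1 * gm 0 1 u))); last by ring.
  by rewrite Q0 Q1 !subrr !mulr0 subrr.
exact: ES.
Qed.

Let trace_b u : U u ->
  gm 1 1 u * b 0 0 u - 2 * (gm 0 1 u * b 0 1 u) + gm 0 0 u * b 1 1 u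
  = - r ^+ 2 * (gm 0 0 u * gm 1 1 u - gm 0 1 u * gm 0 1 u).
Proof.
move=> Uu; have [t0 [t1 E]] := TF Uu.
have := trace_dot u (fun i j => F2 i j u) (L u); rewrite E.
by rewrite !dotE !(dotC (F1 _ _) (L u)) !LF // LL // !(dotC (F2 _ _ _) (L u)) => H; lra.
Qed.

Let trace_b_derive m u : U u ->
  let pg i j := dot (F2 m i u) (F1 j u) + dot (F1 i u) (F2 m j u) in
  let pb i j := dot (L1 m u) (F2 i j u) + dot (L u) (F3 m i j u) in
  (pg 1 1 * b 0 0 u + gm 1 1 u * pb 0 0)
  - 2 * (pg 0 1 * b 0 1 u + gm 0 1 u * pb 0 1)
  + (pg 0 0 * b 1 1 u + gm 0 0 u * pb 1 1)
  = - ((pg 0 0 * gm 1 1 u + gm 0 0 u * pg 1 1 - 2 * (pg 0 1 * gm 0 1 u)) * r ^+ 2).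
Proof.
move=> Uu pg pb.
have D : is_derive u (e m) (fun u =>
    - r ^+ 2 * (gm 0 0 u * gm 1 1 u - gm 0 1 u * gm 0 1 u))
    (- r ^+ 2 * (pg 0 0 * gm 1 1 u + gm 0 0 u * pg 1 1
      - (pg 0 1 * gm 0 1 u + gm 0 1 u * pg 0 1))).
  by apply: is_derive_cmul; apply: is_derive_sub; apply: is_derive_mul; exact: dgm.
transitivity (- r ^+ 2 * (pg 0 0 * gm 1 1 u + gm 0 0 u * pg 1 1 -
   (pg 0 1 * gm 0 1 u + gm 0 1 u * pg 0 1))); last by ring.
apply: (is_derive_unique_on oU Uu trace_b _ D).
apply: is_derive_add; [apply: is_derive_sub|].
- by apply: is_derive_mul; [exact: dgm|exact: db].
- by apply: is_derive_cmul; apply: is_derive_mul; [exact: dgm|exact: db].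
- by apply: is_derive_mul; [exact: dgm|exact: db].
Qed.

(* [det u] times the component of [L1 j u] normal to both [F] and [L]. *)
Local Notation N j u := (det u *: L1 j u
  + (b j 0 u * gm 1 1 u - b j 1 u * gm 0 1 u) *: F1 0 u
  + (b j 1 u * gm 0 0 u - b j 0 u * gm 0 1 u) *: F1 1 u).

Let NF j k u : U u -> dot (N j u) (F1 k u) = 0.
Proof.
move=> Uu; rewrite !dotE LiF //.
by elim/ord2P: k; rewrite ?(dotC (F1 1 u) (F1 0 u)); ring.
Qed.

Let NL j u : U u -> dot (N j u) (L u) = 0.
Proof.
by move=> Uu; rewrite !dotE LiL // !(dotC (F1 _ u) (L u)) !LF // !mulr0 !addr0.
Qed.

(** This is the contraction of [<N_i, F_mj>] with the inverse metric, up to the factor [det u]. The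
    terms in [t0], [t1] cancel because [traces] gives the same coefficients for [F] and [L]. *)
Let N_trace m u : U u ->
  gm 1 1 u * dot (N 0 u) (F2 m 0 u)
  - gm 0 1 u * (dot (N 0 u) (F2 m 1 u) + dot (N 1 u) (F2 m 0 u))
  + gm 0 0 u * dot (N 1 u) (F2 m 1 u) = 0.
Proof.
move=> Uu; have [mu [t0 [t1 [ET ES]]]] := traces Uu.
have HL : gm 1 1 u * dot (L2 0 0 u) (F1 m u)
   - 2 * gm 0 1 u * dot (L2 0 1 u) (F1 m u)
   + gm 0 0 u * dot (L2 1 1 u) (F1 m u) = - (t0 * b 0 m u) - t1 * b 1 m u.
  rewrite -(trace_dot u (fun i j => L2 i j u)) ES !dotE LF // !LiF //.
  by rewrite mulr0 add0r !mulrN.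
have HF : gm 1 1 u * dot (F2 0 0 u) (L1 m u)
   - 2 * gm 0 1 u * dot (F2 0 1 u) (L1 m u)
   + gm 0 0 u * dot (F2 1 1 u) (L1 m u) = - (t0 * b 0 m u) - t1 * b 1 m u.
  rewrite -(trace_dot u (fun i j => F2 i j u)) ET !dotE (dotC (L u)) LiL //.
  rewrite !(dotC (F1 _ u) (L1 m u)) !LiF // mulr0 oppr0 add0r !mulrN.
  by rewrite !(@F2C m).
rewrite !(dotC (F2 _ _ u) (L1 m u)) in HF.
rewrite !dotE !(dotC (F1 _ u) (F2 _ _ u)) (@F2C 1 0) //.
apply: (trace_normal_derivative (q00 := dot (L u) (F3 m 0 0 u))
  (q01 := dot (L u) (F3 m 0 1 u)) (q11 := dot (L u) (F3 m 1 1 u))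
  (trace_b Uu) _ _ _ HL HF).
- by have := @LijF 0 0 m u Uu; rewrite (@F2C 0 m) // F3Cr // (@F3C 0 m).
- by have := @LijF 0 1 m u Uu; rewrite (@F2C 0 m) // (@F2C 1 m) // F3Cr // (@F3C 0 m).
- by have := @LijF 1 1 m u Uu; rewrite (@F2C 1 m) // F3Cr // (@F3C 1 m).
have := trace_b_derive m Uu => /=.
by rewrite !(dotC (F1 _ u) (F2 _ _ u)).
Qed.

(* Both the normal parts of [dL] and the normal part of the Hessian of [F] lie on
   the line orthogonal to [F1 0], [F1 1] and [L]; there [N_trace] says that the
   trace-free form <n, F2> kills a nonzero vector. *)
Let N_F2 i j k u : U u -> dot (N i u) (F2 j k u) = 0.
Proof.
move=> Uu.
have [Ni0|Ni0] := eqVneq (N i u) 0; first by rewrite Ni0 dot0l.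
have Ltrue0 : L u != 0 by rewrite -dot_gt0 LL // exprn_gt0.
have dn0 := lt0r_neq0 (det_gt0 Uu).
have [n En] : {n | n = N i u} by exists (N i u).
have nF k' : dot n (F1 k' u) = 0 by rewrite En NF.
have nL : dot n (L u) = 0 by rewrite En NL.
rewrite -!En in Ni0 *.
have nn0 : dot n n != 0 by rewrite dot_eq0.
pose c m := dot (N m u) n / dot n n.
have NE m : N m u = c m *: n.
  apply/eqP; rewrite -subr_eq0; apply/eqP.
  apply: (orth4_eq0 dn0 Ltrue0 Ni0); rewrite ?LF ?(dotBl, dotZl) ?nF ?nL ?NF ?NL ?mulr0 ?subr0 //.
  by rewrite /c divfK // subrr.
have ci : c i = 1 by rewrite /c -En divff.
have [p00 p01 p11] : [/\ dot n (F2 0 0 u) = 0, dot n (F2 0 1 u) = 0 & dot n (F2 1 1 u) = 0].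
  (* Up to the factor [det u], [(y0, y1)] is the covector [c] with its index raised; [N_trace] for
     [m = 0, 1] puts it in the kernel. *)
  apply: (tracefree_ker_eq0 (g00 := gm 0 0 u) (g01 := gm 0 1 u) (g11 := gm 1 1 u)
    (y0 := gm 1 1 u * c 0 - gm 0 1 u * c 1) (y1 := gm 0 0 u * c 1 - gm 0 1 u * c 0)).
  - exact: g00_gt0.
  - exact: det_gt0.
  - rewrite -negb_and; apply/negP => /andP[/eqP y0 /eqP y1].
    have : det u * c i = 0.
      elim/ord2P: (i).
        transitivity (gm 0 0 u * (gm 1 1 u * c 0 - gm 0 1 u * c 1)
          + gm 0 1 u * (gm 0 0 u * c 1 - gm 0 1 u * c 0)); first by ring.
        by rewrite y0 y1 !mulr0 addr0.
      transitivity (gm 0 1 u * (gm 1 1 u * c 0 - gm 0 1 u * c 1)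
          + gm 1 1 u * (gm 0 0 u * c 1 - gm 0 1 u * c 0)); first by ring.
      by rewrite y0 y1 !mulr0 addr0.
    by rewrite ci mulr1 => /eqP; rewrite (negPf dn0).
  - have [t0 [t1 E]] := TF Uu.
    have := trace_dot u (fun i j => F2 i j u) n; rewrite E !dotE.
    rewrite (dotC (L u) n) !(dotC (F1 _ u) n) !(dotC (F2 _ _ u) n) nL !nF // => <-.
    by rewrite !mulr0 oppr0 !addr0.
  - have := N_trace 0 Uu; rewrite !NE !dotZl => H.
    by rewrite -[RHS]H; ring.
  - have := N_trace 1 Uu; rewrite !NE !dotZl (@F2C 1 0) // => H.
    by rewrite -[RHS]H; ring.
by elim/ord2P: j; elim/ord2P: k => //; rewrite F2C.
Qed.

(* Where [N i] does not vanish it spans the remaining normal line, [F2] has no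
   component along it, and the Codazzi equation makes [b j k * dot n (L1 l)]
   symmetric in [j] and [l]; hence [dL] would annihilate a tangent vector. *)
Let N_eq0 i u : U u -> N i u = 0.
Proof.
move=> Uu; apply/eqP; apply/negPn/negP => Ni0.
have Ltrue0 : L u != 0 by rewrite -dot_gt0 LL // exprn_gt0.
have dn0 := lt0r_neq0 (det_gt0 Uu).
have r2n0 : r ^+ 2 != 0 by rewrite gt_eqF // exprn_gt0.
have [n En] : {n | n = (fun u => N i u)} by exists (fun u => N i u).
have nE z : n z = N i z by rewrite En.
have nF k z : U z -> dot (n z) (F1 k z) = 0 by move=> Uz; rewrite nE NF.
have nL z : U z -> dot (n z) (L z) = 0 by move=> Uz; rewrite nE NL.
have nF2 j k z : U z -> dot (n z) (F2 j k z) = 0 by move=> Uz; rewrite nE N_F2.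
have n0 : n u != 0 by rewrite nE.
(* [N i] is polynomial in quantities with known derivatives. What is used about its own derivative
   is recovered later from products with [n] that vanish throughout [U]. *)
have dn l : exists D, is_derive u (e l) n D.
  rewrite En; eexists; apply: is_deriveD; [apply: is_deriveD|].
  - apply: is_derive_scale; last exact: dL1.
    apply: is_derive_sub; first by apply: is_derive_mul; exact: dgm.
    by apply: is_derive_sqr; exact: dgm.
  - apply: is_derive_scale; last exact: dF1.
    by apply: is_derive_sub; apply: is_derive_mul; (exact: dgm || exact: db).
  - apply: is_derive_scale; last exact: dF1.
    by apply: is_derive_sub; apply: is_derive_mul; (exact: dgm || exact: db).
have const0 l h D : (forall z, U z -> h z = 0) -> is_derive u (e l) h D -> D = 0 :> R.
  by move=> h0 hD; exact: (is_derive_unique_on oU Uu h0 hD (is_derive_cst (0 : R) u (e l))).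
have F2E j k : exists p q, F2 j k u = p *: F1 0 u + q *: F1 1 u + (b j k u / r ^+ 2) *: L u.
  exists ((dot (F2 j k u) (F1 0 u) * gm 1 1 u - dot (F2 j k u) (F1 1 u) * gm 0 1 u) / det u).
  exists ((dot (F2 j k u) (F1 1 u) * gm 0 0 u - dot (F2 j k u) (F1 0 u) * gm 0 1 u) / det u).
  apply/eqP; rewrite -subr_eq0; apply/eqP.
  apply: (orth4_eq0 dn0 Ltrue0 n0); rewrite ?LF ?nF ?nL //.
  - rewrite !(dotBl, dotDl, dotZl) LF // (dotC (F1 1 u) (F1 0 u)) mulr0 addr0.
    by rewrite (cramer2 _ _ dn0).1 subrr.
  - rewrite !(dotBl, dotDl, dotZl) LF // mulr0 addr0.
    by rewrite (cramer2 _ _ dn0).2 subrr.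
  - rewrite !(dotBl, dotDl, dotZl) !(dotC (F1 _ u) (L u)) !LF // LL // (dotC (F2 _ _ _)).
    by rewrite !mulr0 !add0r divfK // subrr.
  - by rewrite !(dotBl, dotDl, dotZl) !(dotC _ (n u)) nF2 // !nF // nL // !mulr0 !addr0 subr0.
(* Differentiating [<n, F1> = 0] shows [D] orthogonal to the tangent plane, so against [F2 j k] it
   sees only the [L] component, known from [<n, L> = 0]. Third derivatives commute, which makes the
   right side symmetric. *)
have codazzi j k l : b j k u * dot (n u) (L1 l u) = r ^+ 2 * dot (n u) (F3 l j k u).
  have [D nD] := dn l.
  have D0 m : dot D (F1 m u) = 0.
    have := const0 _ _ _ (nF m) (is_derive_dot nD (dF1 l m Uu)).
    by rewrite nF2 // addr0.
  have DL : dot D (L u) = - dot (n u) (L1 l u).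
    by have := const0 _ _ _ nL (is_derive_dot nD (dL l Uu)); lra.
  have := const0 _ _ _ (nF2 j k) (is_derive_dot nD (dF2 l j k Uu)).
  have -> : dot D (F2 j k u) = - (b j k u / r ^+ 2 * dot (n u) (L1 l u)).
    have [p [q EF]] := F2E j k.
    by rewrite [in LHS]EF !(dotDr, dotZr) !D0 DL !mulr0 !add0r mulrN.
  move=> H.
  transitivity (r ^+ 2 * (b j k u / r ^+ 2 * dot (n u) (L1 l u))).
    by rewrite mulrA (mulrC (r ^+ 2)) divfK.
  by congr (_ * _); lra.
have sym j k l : b j k u * dot (n u) (L1 l u) = b l k u * dot (n u) (L1 j u).
  by rewrite !codazzi F3C.
set y0 := dot (n u) (L1 0 u) in sym; set y1 := dot (n u) (L1 1 u) in sym.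
(* The vector [(y1, - y0)] is annihilated by the covector [y], so its image under [dL] has no part
   along [n]; it has none along [L], and none in the tangent plane by [sym]. *)
have w0 : y1 *: L1 0 u - y0 *: L1 1 u = 0.
  apply: (orth4_eq0 dn0 Ltrue0 n0); rewrite ?LF ?nF ?nL //.
  - by rewrite dotBl !dotZl !LiF //; have := sym 0 0 1; rewrite -/y0 -/y1; lra.
  - by rewrite dotBl !dotZl !LiF //; have := sym 0 1 1; rewrite -/y0 -/y1; lra.
  - by rewrite dotBl !dotZl !LiL // !mulr0 subr0.
  - by rewrite dotBl !dotZl !(dotC _ (n u)) -/y0 -/y1; ring.
have [s s0 Es] := conf Uu.
have y : (y1 != 0) || (- y0 != 0).
  rewrite oppr_eq0 -negb_and; apply/negP => /andP[/eqP y10 /eqP y00].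
  move: n0; rewrite -dot_eq0 {2}nE !(dotDr, dotZr) !nF // !mulr0 !addr0.
  suff -> : dot (n u) (L1 i u) = 0 by rewrite mulr0 eqxx.
  by elim/ord2P: (i).
have := posdef2 (g00_gt0 Uu) (det_gt0 Uu) y; rewrite -(pmulr_rgt0 _ s0).
suff -> : s * (gm 0 0 u * y1 ^+ 2 + 2 * gm 0 1 u * y1 * - y0 + gm 1 1 u * (- y0) ^+ 2)
    = dot (y1 *: L1 0 u - y0 *: L1 1 u) (y1 *: L1 0 u - y0 *: L1 1 u).
  by rewrite w0 dot0l ltxx.
by rewrite !(dotBl, dotBr, dotZl, dotZr) !Es (dotC (F1 1 u) (F1 0 u)); ring.
Qed.

Lemma conformal_normal_derive i u : U u -> L1 i u = (r ^+ 2 / 2) *: F1 i u.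
Proof.
move=> Uu; have dn0 := lt0r_neq0 (det_gt0 Uu).
have [s _ Es] := conf Uu.
have NE j : det u *: L1 j u =
    - (b j 0 u * gm 1 1 u - b j 1 u * gm 0 1 u) *: F1 0 u
    - (b j 1 u * gm 0 0 u - b j 0 u * gm 0 1 u) *: F1 1 u.
  by have := N_eq0 j Uu => /eqP; rewrite -addrA addr_eq0 => /eqP ->; rewrite opprD scaleNr.
(* As [dL] is now tangential, conformality says that the shape operator in the direction [L] has
   square [s] times the identity. *)
have E j k : det u * (s * gm j k u) =
    (b j 0 u * gm 1 1 u - b j 1 u * gm 0 1 u) * b k 0 u
    + (b j 1 u * gm 0 0 u - b j 0 u * gm 0 1 u) * b k 1 u.
  rewrite -Es -dotZl NE dotBl !dotZl !(dotC (F1 _ u) (L1 _ u)) !LiF //; ring.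
have Tb : gm 1 1 u * b 0 0 u - 2 * (gm 0 1 u * b 0 1 u) + gm 0 0 u * b 1 1 u
  = - r ^+ 2 * det u by rewrite trace_b // expr2.
have bC : b 1 0 u = b 0 1 u by rewrite F2C.
pose k := det u * s + (b 0 0 u * b 1 1 u - b 0 1 u ^+ 2).
(* Cayley-Hamilton for the shape operator in the direction [L]. *)
have bE i' j' : - r ^+ 2 * det u * b i' j' u = k * gm i' j' u.
  rewrite -Tb /k [RHS]mulrDl -(mulrA (det u) s) E.
  by elim/ord2P: i'; elim/ord2P: j'; rewrite ?bC ?(dotC (F1 1 u) (F1 0 u)); ring.
(* The trace of [bE] against the metric determines [k]. *)
have kE : k = det u * (r ^+ 2) ^+ 2 / 2.
  apply: (mulfI dn0).
  have H : - r ^+ 2 * det u * (- r ^+ 2 * det u) = 2 * (k * det u).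
    rewrite -{2}Tb mulrDr mulrBr.
    transitivity (gm 1 1 u * (- r ^+ 2 * det u * b 0 0 u)
      - 2 * (gm 0 1 u * (- r ^+ 2 * det u * b 0 1 u))
      + gm 0 0 u * (- r ^+ 2 * det u * b 1 1 u)); first by ring.
    by rewrite !bE; ring.
  rewrite (mulrC _ k); lra.
have r2n0 : r ^+ 2 != 0 by rewrite gt_eqF // exprn_gt0.
have {}bE i' j' : b i' j' u = - (r ^+ 2 / 2) * gm i' j' u.
  have := bE i' j'; rewrite kE => H.
  apply: (mulfI (_ : - r ^+ 2 * det u != 0)); first by rewrite mulf_neq0 // oppr_eq0.
  by rewrite H; field.
apply: (scalerI dn0); rewrite NE !bE scalerA.
have lin (p q p' q' : R) : p = p' -> q = q' ->
  p *: F1 0 u - q *: F1 1 u = p' *: F1 0 u - q' *: F1 1 u by move=> -> ->.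
elim/ord2P: i; rewrite ?(dotC (F1 1 u) (F1 0 u)).
  by rewrite (lin _ _ (det u * (r ^+ 2 / 2)) 0); [rewrite scale0r subr0|ring|ring].
rewrite (lin _ _ 0 (- (det u * (r ^+ 2 / 2)))); [|ring|ring].
by rewrite scale0r sub0r scaleNr opprK.
Qed.

End ConformalNormal.

(** * Second fundamental form and Laplacian at a point *)

Section Pointwise.
Variables (R : realType) (n : nat).
Implicit Types (f : 'I_2 -> 'rV[R]_n) (G : 'M[R]_2) (w y : 'rV[R]_n).

Definition gram f : 'M[R]_2 := \matrix_(i, j) dot (f i) (f j).

Lemma det2_gram f :
  det2 (gram f) = dot (f 0) (f 0) * dot (f 1) (f 1) - dot (f 0) (f 1) ^+ 2.
Proof. by rewrite /det2 !mxE (dotC (f 1) (f 0)) expr2. Qed.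

Lemma gramZ k f : gram (fun i => k *: f i) = k ^+ 2 *: gram f.
Proof. by apply/matrixP => i j; rewrite !mxE dotZl dotZr mulrA -expr2. Qed.

Lemma det2Z k G : det2 (k *: G) = k ^+ 2 * det2 G.
Proof. by rewrite /det2 !mxE; ring. Qed.

Lemma cotraceZl k G (B : 'I_2 -> 'I_2 -> 'rV[R]_n) :
  cotrace (k *: G) B = k *: cotrace G B.
Proof. by rewrite /cotrace !mxE !(scalerDr, scalerN, scalerA). Qed.

Lemma cotraceZr k G (B : 'I_2 -> 'I_2 -> 'rV[R]_n) :
  cotrace G (fun i j => k *: B i j) = k *: cotrace G B.
Proof.
by rewrite /cotrace !(scalerDr, scalerN, scalerA) !(mulrC k).
Qed.

Lemma cotrace_lin G (B : 'I_2 -> 'I_2 -> 'rV[R]_n) (P : 'rV[R]_n -> 'rV[R]_n) :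
  (forall k w w', P (k *: w + w') = k *: P w + P w') ->
  cotrace G (fun i j => P (B i j)) = P (cotrace G B).
Proof.
move=> lin.
have P0 : P 0 = 0 by have := lin (-1) 0 0; rewrite scaler0 addr0 scaleN1r addNr.
have PZ k w : P (k *: w) = k *: P w by rewrite -[k *: w]addr0 lin P0 addr0.
by rewrite /cotrace -!scaleNr -!addrA !lin PZ.
Qed.

Lemma dot_cotrace G (B : 'I_2 -> 'I_2 -> 'rV[R]_n) w :
  dot w (cotrace G B) =
  G 1 1 * dot w (B 0 0) - G 0 1 * dot w (B 0 1) - G 1 0 * dot w (B 1 0)
  + G 0 0 * dot w (B 1 1).
Proof. by rewrite /cotrace !dotE. Qed.

Lemma tangent_cotrace f w : cotrace (gram f) (fun k l => dot w (f l) *: f k) =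
  (dot w (f 0) * dot (f 1) (f 1) - dot w (f 1) * dot (f 0) (f 1)) *: f 0
  + (dot w (f 1) * dot (f 0) (f 0) - dot w (f 0) * dot (f 0) (f 1)) *: f 1.
Proof.
by apply/rowP => i; rewrite !mxE (dotC (f 1) (f 0)); ring.
Qed.

(** The normal part [v] of [w] is itself an admissible test vector, and [<v, v> = <v, w> = 0]. *)
Lemma tangent_span f w : det2 (gram f) != 0 ->
  (forall v, (forall i, dot v (f i) = 0) -> dot v w = 0) ->
  exists t0 t1, w = t0 *: f 0 + t1 *: f 1.
Proof.
rewrite det2_gram => d0 wn.
set d := _ - _ in d0.
exists ((dot w (f 0) * dot (f 1) (f 1) - dot w (f 1) * dot (f 0) (f 1)) / d).
exists ((dot w (f 1) * dot (f 0) (f 0) - dot w (f 0) * dot (f 0) (f 1)) / d).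
set t0 := _ / d; set t1 := _ / d.
have [c0 c1] := cramer2 (dot w (f 0)) (dot w (f 1)) d0.
pose v := w - (t0 *: f 0 + t1 *: f 1).
have vf : forall i, dot v (f i) = 0.
  apply: ord2P; rewrite dotBl dotDl !dotZl.
    by rewrite (dotC (f 1) (f 0)) c0 subrr.
  by rewrite c1 subrr.
apply/eqP; rewrite -subr_eq0 -dot_eq0 -/v {2}/v dotBr dotDr !dotZr !vf.
by rewrite wn // !mulr0 addr0 subr0.
Qed.

(* The projection in the definition of [sphere_sff], for a surface with tangent
   vectors [f] in a sphere of radius [r] at the point of position vector [y]. *)
Definition sff_proj f y (r : R) w : 'rV[R]_n :=
  let w' := w - dot w (r^-1 *: y) *: (r^-1 *: y) in
  w' - metric_trace (gram f) (fun k l => dot w' (f l) *: f k).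

Lemma sff_proj_span f y r w : det2 (gram f) != 0 -> r != 0 ->
  dot y y = r ^+ 2 -> (forall i, dot y (f i) = 0) ->
  sff_proj f y r w = 0 <-> exists mu t0 t1, w = mu *: y + t0 *: f 0 + t1 *: f 1.
Proof.
move=> d0 r0 yy yf; rewrite /sff_proj metric_traceE // tangent_cotrace.
split=> [/eqP|[mu [t0 [t1 ->]]]].
  set w' := w - _; rewrite subr_eq0 => /eqP.
  set a := dot w' (f 0) * _ - _; set b := dot w' (f 1) * _ - _ => E.
  exists (dot w (r^-1 *: y) / r), ((det2 (gram f))^-1 * a), ((det2 (gram f))^-1 * b).
  have Ew : w = dot w (r^-1 *: y) *: (r^-1 *: y) + w' by rewrite /w' addrC subrK.
  by rewrite {1}Ew E scalerDr !scalerA addrA.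
have fy i : dot (f i) y = 0 by rewrite dotC yf.
have -> : dot (mu *: y + t0 *: f 0 + t1 *: f 1) (r^-1 *: y) = mu * r.
  by rewrite !(dotDl, dotZl, dotZr) yy !fy !mulr0 !addr0; field.
have -> : mu *: y + t0 *: f 0 + t1 *: f 1 - (mu * r) *: (r^-1 *: y) =
    t0 *: f 0 + t1 *: f 1.
  by rewrite scalerA mulfK // -(addrA (mu *: y)) addrAC subrr add0r.
rewrite !(dotDl, dotZl) (dotC (f 1) (f 0)).
set a := (t0 * _ + _) * _ - _; set b := (t0 * _ + _) * _ - _.
have -> : a = det2 (gram f) * t0 by rewrite det2_gram /a; ring.
have -> : b = det2 (gram f) * t1 by rewrite det2_gram /b; ring.
by rewrite -!scalerA -scalerDr scalerA mulVf // scale1r subrr.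
Qed.

Lemma sff_proj_lin f y r k w w' :
  det2 (gram f) != 0 -> sff_proj f y r (k *: w + w') = k *: sff_proj f y r w + sff_proj f y r w'.
Proof.
move=> d0; rewrite /sff_proj !metric_traceE // !tangent_cotrace.
apply/rowP => i; rewrite !(mxE, dotDl, dotNl, dotZl); ring.
Qed.

(** The projection is linear and commutes with the trace, so minimality becomes a condition on the
    trace of plain second derivatives, easy to rescale. *)
Lemma sff_trace_span f y r (B : 'I_2 -> 'I_2 -> 'rV[R]_n) : det2 (gram f) != 0 -> r != 0 ->
  dot y y = r ^+ 2 -> (forall i, dot y (f i) = 0) ->
  2^-1 *: metric_trace (gram f) (fun i j => sff_proj f y r (B i j)) = 0 <->
  exists mu t0 t1, cotrace (gram f) B = mu *: y + t0 *: f 0 + t1 *: f 1.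
Proof.
move=> d0 r0 yy yf; rewrite -(sff_proj_span _ d0 r0 yy yf) metric_traceE //.
rewrite (cotrace_lin _ _ (fun k w w' => sff_proj_lin y r k w w' d0)).
split=> [/eqP|->]; last by rewrite !scaler0.
by rewrite !scaler_eq0 !invr_eq0 pnatr_eq0 (negPf d0) => /eqP.
Qed.

(** Gauss formula: the bracket of metric derivatives equals [2 * dot (f2 i j) (f l)], so the
    Christoffel sum is the tangential part of [f2 i j]. *)
Lemma christoffel_normal f (f2 : 'I_2 -> 'I_2 -> 'rV[R]_n)
    (dg : 'I_2 -> 'I_2 -> 'I_2 -> R) i j m : det2 (gram f) != 0 ->
  (forall i j, f2 i j = f2 j i) ->
  (forall i j k, dg i j k = dot (f2 i j) (f k) + dot (f j) (f2 i k)) ->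
  dot (f2 i j - \sum_(k < 2)
    (2^-1 * \sum_(l < 2) invmx (gram f) k l * (dg i j l + dg j i l - dg l i j)) *: f k)
    (f m) = 0.
Proof.
move=> d0 f2C dgE; have [E00 E01 E10 E11] := invmx2 d0.
rewrite !sum2 E00 E01 E10 E11 !mxE (dotC (f 1) (f 0)).
rewrite !(dotBl, dotDl, dotZl) !dgE !(dotC (f _) (f2 _ _)) !(f2C _ i) !(f2C _ j).
set iv := (det2 _)^-1.
have iE : iv * (dot (f 0) (f 0) * dot (f 1) (f 1) - dot (f 0) (f 1) ^+ 2) = 1.
  by rewrite -det2_gram mulVf.
rewrite !(dotNl, dotDl, dotZl).
elim/ord2P: m; rewrite ?(dotC (f 1) (f 0)).
  transitivity (dot (f2 j i) (f 0) - dot (f2 j i) (f 0) *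
    (iv * (dot (f 0) (f 0) * dot (f 1) (f 1) - dot (f 0) (f 1) ^+ 2))).
    by field.
  by rewrite iE mulr1 subrr.
transitivity (dot (f2 j i) (f 1) - dot (f2 j i) (f 1) *
  (iv * (dot (f 0) (f 0) * dot (f 1) (f 1) - dot (f 0) (f 1) ^+ 2))).
  by field.
by rewrite iE mulr1 subrr.
Qed.

(** The two conclusions determine [l] and, unlike the defining formula, can be carried from one
    chart to another. *)
Lemma laplace_normal f (f2 : 'I_2 -> 'I_2 -> 'rV[R]_n)
    (dg : 'I_2 -> 'I_2 -> 'I_2 -> R) l : det2 (gram f) != 0 ->
  (forall i j, f2 i j = f2 j i) ->
  (forall i j k, dg i j k = dot (f2 i j) (f k) + dot (f j) (f2 i k)) ->
  l = - metric_trace (gram f) (fun i j => f2 i j - \sum_(k < 2)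
    (2^-1 * \sum_(l < 2) invmx (gram f) k l * (dg i j l + dg j i l - dg l i j)) *: f k) ->
  (forall i, dot l (f i) = 0) /\
  forall v, (forall i, dot v (f i) = 0) ->
    dot v (cotrace (gram f) f2) = - det2 (gram f) * dot v l.
Proof.
move=> d0 f2C dgE ->; rewrite metric_traceE //; split=> [m|v vf].
  rewrite dotNl dotZl dotC dot_cotrace !(dotC (f m)) !(christoffel_normal _ _ _ d0 f2C dgE).
  by rewrite !mulr0 !subr0 addr0 mulr0 oppr0.
rewrite dotNr dotZr mulrNN mulrA divff // mul1r !dot_cotrace.
have E i j (c : 'I_2 -> R) : dot v (f2 i j - \sum_(k < 2) c k *: f k) = dot v (f2 i j).
  by rewrite sum2 dotBr dotDr !dotZr !vf !mulr0 addr0 subr0.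
by rewrite !E.
Qed.

Lemma det2_change (f h : 'I_2 -> 'rV[R]_n) (J : 'M[R]_2) :
  (forall i, f i = J i 0 *: h 0 + J i 1 *: h 1) ->
  det2 (gram f) = det2 J ^+ 2 * det2 (gram h).
Proof.
move=> fE; rewrite !det2_gram !fE !(dotDl, dotDr, dotZl, dotZr).
by rewrite (dotC (h 1) (h 0)) /det2; ring.
Qed.

(** [cotrace] is an invariant trace times the Gram determinant, which picks up the square of the
    Jacobian. *)
Lemma cotrace_change (f h : 'I_2 -> 'rV[R]_n) (J : 'M[R]_2) (B C : 'I_2 -> 'I_2 -> 'rV[R]_n) v :
  (forall i, f i = J i 0 *: h 0 + J i 1 *: h 1) ->
  (forall i j, dot v (B i j) =
     J i 0 * J j 0 * dot v (C 0 0) + J i 0 * J j 1 * dot v (C 0 1)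
     + J i 1 * J j 0 * dot v (C 1 0) + J i 1 * J j 1 * dot v (C 1 1)) ->
  dot v (cotrace (gram f) B) = det2 J ^+ 2 * dot v (cotrace (gram h) C).
Proof.
move=> fE BE; rewrite !dot_cotrace !BE !mxE !fE !(dotDl, dotDr, dotZl, dotZr).
by rewrite (dotC (h 1) (h 0)) /det2; ring.
Qed.

Lemma normal_change (f h : 'I_2 -> 'rV[R]_n) (J : 'M[R]_2) v : det2 (gram f) != 0 ->
  (forall i, f i = J i 0 *: h 0 + J i 1 *: h 1) ->
  (forall i, dot v (f i) = 0) -> forall i, dot v (h i) = 0.
Proof.
move=> d0 fE vf; have := d0; rewrite (det2_change fE) mulf_eq0 negb_or sqrf_eq0.
case/andP=> J0 _.
have := vf 0; have := vf 1; rewrite !fE !(dotDr, dotZr) => E1 E0.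
apply: ord2P; apply: (mulfI J0); rewrite mulr0 /det2.
  transitivity (J 1 1 * (J 0 0 * dot v (h 0) + J 0 1 * dot v (h 1))
    - J 0 1 * (J 1 0 * dot v (h 0) + J 1 1 * dot v (h 1))); first by ring.
  by rewrite E0 E1 !mulr0 subrr.
transitivity (J 0 0 * (J 1 0 * dot v (h 0) + J 1 1 * dot v (h 1))
  - J 1 0 * (J 0 0 * dot v (h 0) + J 0 1 * dot v (h 1))); first by ring.
by rewrite E0 E1 !mulr0 subrr.
Qed.

(** [K] holds the second derivatives of the coordinate change. They multiply tangent vectors only
    and disappear against a normal vector. *)
Lemma laplace_change (f h : 'I_2 -> 'rV[R]_n) (J : 'I_2 -> 'I_2 -> R)
    (K : 'I_2 -> 'I_2 -> 'I_2 -> R) (f2 h2 : 'I_2 -> 'I_2 -> 'rV[R]_n) l :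
  det2 (gram f) != 0 ->
  (forall i, f i = J i 0 *: h 0 + J i 1 *: h 1) ->
  (forall i j, f2 i j =
    (K i j 0 *: h 0 + J j 0 *: (J i 0 *: h2 0 0 + J i 1 *: h2 1 0)) +
    (K i j 1 *: h 1 + J j 1 *: (J i 0 *: h2 0 1 + J i 1 *: h2 1 1))) ->
  (forall i, dot l (h i) = 0) /\
  (forall v, (forall i, dot v (h i) = 0) ->
    dot v (cotrace (gram h) h2) = - det2 (gram h) * dot v l) ->
  (forall i, dot l (f i) = 0) /\
  (forall v, (forall i, dot v (f i) = 0) ->
    dot v (cotrace (gram f) f2) = - det2 (gram f) * dot v l).
Proof.
move=> d0 fE f2E [lh lT]; split=> [i|v vf].
  by rewrite fE dotDr !dotZr !lh !mulr0 addr0.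
pose Jm : 'M[R]_2 := \matrix_(i, k) J i k.
have fJ i : f i = Jm i 0 *: h 0 + Jm i 1 *: h 1 by rewrite !mxE.
have vh := normal_change d0 fJ vf.
rewrite (cotrace_change (C := h2) fJ) => [|i j].
  by rewrite lT // (det2_change fJ); ring.
by rewrite f2E !mxE !(dotDr, dotZr) !vh; ring.
Qed.

(** Pairing the trace with [y] gives [mu]. The difference of the two sides is then a normal vector,
    and testing with it shows that its square is zero. *)
Lemma laplace_of_sphere f (f2 : 'I_2 -> 'I_2 -> 'rV[R]_n) l y r mu t0 t1 :
  det2 (gram f) != 0 -> r != 0 -> dot y y = r ^+ 2 ->
  (forall i, dot y (f i) = 0) -> (forall i j, dot y (f2 i j) = - dot (f i) (f j)) ->
  (forall i, dot l (f i) = 0) /\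
  (forall v, (forall i, dot v (f i) = 0) ->
    dot v (cotrace (gram f) f2) = - det2 (gram f) * dot v l) ->
  cotrace (gram f) f2 = mu *: y + t0 *: f 0 + t1 *: f 1 ->
  l = (2 / r ^+ 2) *: y.
Proof.
move=> d0 r0 yy yf yf2 [lf lT] T.
have r20 : r ^+ 2 != 0 by rewrite expf_neq0.
have muE : mu * r ^+ 2 = - 2 * det2 (gram f).
  have := dot_cotrace (gram f) f2 y.
  rewrite T !(dotDr, dotZr) !yf !yf2 yy !mulr0 !addr0 => ->.
  by rewrite det2_gram !mxE (dotC (f 1) (f 0)); ring.
pose v := l - (2 / r ^+ 2) *: y.
have vf i : dot v (f i) = 0 by rewrite dotBl dotZl lf yf mulr0 subr0.
have := lT v vf; rewrite T !(dotDr, dotZr) !vf !mulr0 !addr0 => E.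
apply/eqP; rewrite -subr_eq0 -/v -dot_eq0 {2}/v dotBr dotZr; apply/eqP.
apply: (mulfI d0); apply: (mulIf r20); rewrite mulr0 mul0r.
have -> : det2 (gram f) * (dot v l - 2 / r ^+ 2 * dot v y) * r ^+ 2 =
    det2 (gram f) * dot v l * r ^+ 2 - 2 * det2 (gram f) * dot v y by field.
have -> : det2 (gram f) * dot v l = - (mu * dot v y) by rewrite E mulNr opprK.
transitivity (- ((mu * r ^+ 2) * dot v y) - 2 * det2 (gram f) * dot v y); first by ring.
by rewrite muE; ring.
Qed.

Lemma bilin_delta G i j : bilin G (delta_mx 0 i) (delta_mx 0 j) = G i j.
Proof. by rewrite /bilin -rowE trmx_delta -colE !mxE. Qed.

Lemma pos_gram f G : (forall v : 'rV[R]_2, v != 0 -> 0 < bilin G v v) -> gram f = G ->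
  0 < dot (f 0) (f 0) /\ 0 < det2 (gram f).
Proof.
move=> Gpos fG; have bE (a b : R) : bilin G (\row_i if i == 0 then a else b)
    (\row_i if i == 0 then a else b) =
    a ^+ 2 * dot (f 0) (f 0) + 2 * (a * b * dot (f 0) (f 1)) + b ^+ 2 * dot (f 1) (f 1).
  rewrite -fG /bilin !mxE sum2 !mxE sum2 sum2 !mxE /= (dotC (f 1) (f 0)); ring.
have nz (a b : R) : (a != 0) || (b != 0) -> (\row_i (if i == 0 then a else b)) != 0 :> 'rV[R]_2.
  apply: contraTneq => /rowP E; have := E 0; have := E 1; rewrite !mxE /= => -> ->.
  by rewrite eqxx.
have g0 : 0 < dot (f 0) (f 0).
  have := Gpos _ (nz 1 0 _); rewrite bE oner_neq0 => /(_ isT).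
  by rewrite expr1n expr0n mul1r mulr0 !mul0r mulr0 !addr0.
(* The vector [(- g01, g00)] has squared length [g00] times the determinant. *)
split=> //; have := Gpos _ (nz (- dot (f 0) (f 1)) (dot (f 0) (f 0)) _).
rewrite (lt0r_neq0 g0) orbT bE => /(_ isT) H.
rewrite -(pmulr_rgt0 _ g0) det2_gram; move: H; congr (is_true (0 < _)); ring.
Qed.

End Pointwise.

(** * The Laplacian in arbitrary charts *)

Section Local.
Variables (R : realType) (V W : normedModType R).

Lemma differentiable_near0 (h : V -> W) x : (\near x, h x = 0) -> differentiable h x.
Proof.
move=> h0.
have E : h \o shift x = cst (h x) + (0 : V -> W) +o_ 0 id.
  apply/eqaddoP => _ /posnumP[eps] /=.
  have := h0; rewrite (near_shift 0 x) /= => h0'.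
  near=> y.
  rewrite !fctE /= addr0 (nbhs_singleton h0) subr0.
  have -> : h (y + x) = 0 by near: y; apply: filterS h0' => z /=; rewrite subr0.
  by rewrite normr0 mulr_ge0.
have dh : 'd h x = (0 : V -> W) :> (V -> W).
  by apply: (@diff_unique _ _ _ _ (\0 : {linear V -> W})) => //; exact: cst_continuous.
apply/diff_locallyP; rewrite dh; split => //; exact: cst_continuous.
Unshelve. all: by end_near. Qed.

Lemma near_eq_differentiable (f g : V -> W) x :
  (\near x, f x = g x) -> differentiable f x -> differentiable g x.
Proof.
move=> fg fd.
have -> : g = f + (g - f) by rewrite addrC subrK.
apply: (differentiableD fd); apply: differentiable_near0.
by apply: filterS fg => y E; rewrite !fctE E subrr.
Qed.

(** Rules for ['D_v] are available only on [U], where the functions are differentiable, so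
    inductions on the order of smoothness need this locality. *)
Lemma Ck_on_eq (U : set V) k (f g : V -> W) : open U ->
  (forall z, U z -> f z = g z) -> Ck_on k U f -> Ck_on k U g.
Proof.
move=> oU; elim: k f g => [|k IH] f g fg /=.
  move=> fc u Uu; rewrite /prop_for /continuous_at -(fg u Uu).
  apply: cvg_trans (fc u Uu); apply: near_eq_cvg.
  by apply: filterS (open_nbhs_nbhs (conj oU Uu)) => z Uz; rewrite fg.
have nfg u : U u -> \near u, f u = g u.
  by move=> Uu; apply: filterS (open_nbhs_nbhs (conj oU Uu)) => z; exact: fg.
move=> [fd fD]; split=> [u Uu|v].
  exact: near_eq_differentiable (nfg u Uu) (fd u Uu).
apply: IH (fD v) => u Uu.
exact: near_eq_derive (nfg u Uu).
Qed.

Lemma smooth_scale (U : set V) (f : V -> W) (k : R) : open U ->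
  smooth_on U f -> smooth_on U (fun u => k *: f u).
Proof.
move=> oU fs m; elim: m f fs => [|m IH] f fs /=.
  by move=> u Uu; exact: (continuousZl_tmp (fs 0%N u Uu)).
have fd u : U u -> differentiable f u by move=> Uu; exact: (fs 1%N).1.
split=> [u Uu|v]; first exact/differentiableZ/fd.
apply: (Ck_on_eq oU _ (IH _ (smooth_derive v fs))) => u Uu.
by rewrite -deriveZ //; exact/diff_derivable/fd.
Qed.

Lemma smooth_subc (U : set V) (f : V -> W) (a : W) : open U ->
  smooth_on U f -> smooth_on U (fun u => f u - a).
Proof.
move=> oU fs [|m] /=.
  by move=> u Uu; apply: cvgB; [exact: (fs 0%N u Uu)|exact: cvg_cst].
have fd u : U u -> differentiable f u by move=> Uu; exact: (fs 1%N).1.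
split=> [u Uu|v]; first by apply: differentiableB; [exact: fd|exact: differentiable_cst].
apply: (Ck_on_eq oU _ (smooth_derive v fs m)) => u Uu.
by rewrite deriveB ?derive_cst ?subr0 //; exact/diff_derivable/fd.
Qed.

End Local.

Section Plane.
Variable R : realType.

Lemma derive_rV2 (W : normedModType R) (f : 'rV[R]_2 -> W) u v :
  differentiable f u -> 'D_v f u = v 0 0 *: pd 0 f u + v 0 1 *: pd 1 f u.
Proof.
move=> fd; rewrite /pd !deriveE // -!linearZ -linearD; congr ('d f u _).
by apply/rowP; apply: ord2P; rewrite !mxE /= !(mulr1, mulr0) ?addr0 ?add0r.
Qed.

Lemma derive_comp_rV2 (W : normedModType R) (f : 'rV[R]_2 -> W)
    (phi : 'rV[R]_2 -> 'rV[R]_2) u v :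
  differentiable phi u -> differentiable f (phi u) ->
  'D_v (f \o phi) u =
  ('D_v phi u) 0 0 *: pd 0 f (phi u) + ('D_v phi u) 0 1 *: pd 1 f (phi u).
Proof.
move=> dphi df; rewrite deriveE; last exact: differentiable_comp.
by rewrite diff_comp //= -(deriveE _ dphi) -(deriveE _ df) derive_rV2.
Qed.

Lemma cst_on_ball n (U : set 'rV[R]_2) (f : 'rV[R]_2 -> 'rV[R]_n) u : open U -> U u ->
  (forall z v, U z -> is_derive z v f 0) -> \forall z \near u, f z = f u.
Proof.
move=> oU Uu df.
have : \forall z \near u, U z by exact: (open_nbhs_nbhs (conj oU Uu)).
move=> /nbhs_normP[d /= d0 dU]; apply/nbhs_normP; exists d => //= z uz.
apply/rowP => i.
have [s|s _] := @mvt_line _ _ (fun z => f z 0 i) (fun=> 0) u (z - u) 1 ltr01; last first.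
  by rewrite scale1r addrCA subrr addr0 mulr0 => /eqP; rewrite subr_eq0 => /eqP.
move=> /andP[s0 s1].
have Us : U (u + s *: (z - u)).
  apply: dU; rewrite /ball_ /= opprD addNKr normrN normrZ ger0_norm //.
  by apply: le_lt_trans uz; rewrite distrC ler_piMl.
by have := is_derive_coord i (df _ (z - u) Us); rewrite mxE.
Qed.

End Plane.

Section Charts.
Variables (R : realType) (M : surface R) (g : riemannian_metric M).
Variables (x : M -> 'rV[R]_4).
Hypothesis hx : isometric_immersion g x.
Implicit Types (c d : chart R M) (u : 'rV[R]_2).

Let F c := x \o param c.
Let f c u i := pd i (F c) u.
Let f2 c u i j := pd i (pd j (F c)) u.

Lemma smooth_chart c : atlas c -> smooth_on (img c) (x \o param c).
Proof. by move=> ac; exact: hx.1.1. Qed.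

Lemma gram_gmat c u : atlas c -> img c u -> gram (f c u) = gmat g c u.
Proof.
move=> ac iu; apply/matrixP => i j; rewrite mxE -bilin_delta.
have := hx.2 c (param c u) (delta_mx 0 i) (delta_mx 0 j) ac (param_dom iu).
by rewrite /tangent_map (paramK iu).
Qed.

Lemma gram_pos c u : atlas c -> img c u ->
  0 < dot (f c u 0) (f c u 0) /\ 0 < det2 (gram (f c u)).
Proof.
move=> ac iu; apply: pos_gram (gram_gmat ac iu) => v.
exact: gmat_pos.
Qed.

Lemma f2C c u i j : atlas c -> img c u -> f2 c u i j = f2 c u j i.
Proof. by move=> ac iu; exact: (schwarz _ _ (@img_open _ _ c) (smooth_chart ac) iu). Qed.

Lemma gmat_derive c u i j k : atlas c -> img c u ->
  pd i (fun w => gmat g c w j k : R^o) u =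
  dot (f2 c u i j) (f c u k) + dot (f c u j) (f2 c u i k).
Proof.
move=> ac iu.
have D : is_derive u (delta_mx 0 i : 'rV[R]_2) (fun w => dot (f c w j) (f c w k))
    (dot (f2 c u i j) (f c u k) + dot (f c u j) (f2 c u i k)).
  by apply: is_derive_dot; apply: smooth_is_derive iu; apply: smooth_derive;
     exact: smooth_chart.
have [_ <-] := D; apply: near_eq_derive.
apply: filterS (open_nbhs_nbhs (conj (@img_open _ _ c) iu)) => z iz.
by rewrite -(gram_gmat ac iz) mxE.
Qed.

Let normal_laplace c u (l : 'rV[R]_4) :=
  (forall i, dot l (f c u i) = 0) /\
  forall v, (forall i, dot v (f c u i) = 0) ->
    dot v (cotrace (gram (f c u)) (f2 c u)) = - det2 (gram (f c u)) * dot v l.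

Lemma laplace_chart_at p :
  normal_laplace (chart_at p) (Defs.coord (chart_at p) p) (laplace_map g x p).
Proof.
have ac := chart_at_atlas p; have iu := coord_img (chart_at_dom p).
set c := chart_at p in ac iu *; set u := Defs.coord c p in iu *.
apply: (laplace_normal (dg := fun i j k => pd i (fun w => gmat g c w j k : R^o) u)).
- by rewrite gt_eqF // (gram_pos ac iu).2.
- by move=> i j; exact: f2C.
- by move=> i j k; exact: gmat_derive.
- by rewrite (gram_gmat ac iu).
Qed.

Lemma transition_open c d : open (img c `&` param c @^-1` dom d).
Proof.
rewrite openE => u [iu du]; apply: filterI.
  exact: (open_nbhs_nbhs (conj (@img_open _ _ c) iu)).
by apply: (param_continuous iu); exact: (open_nbhs_nbhs (conj (@dom_open _ _ d) du)).
Qed.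

(** [x \o param c] agrees with [(x \o param d) \o phi] only on the overlap [W]; since [W] is open,
    the identity can be differentiated twice. *)
Lemma normal_laplace_transition c d u l : atlas c -> atlas d -> img c u ->
  dom d (param c u) ->
  normal_laplace d (Defs.coord d (param c u)) l -> normal_laplace c u l.
Proof.
move=> ac ad iu du.
pose W := img c `&` param c @^-1` dom d.
have oW : open W by exact: transition_open.
have Wu : W u by [].
pose phi := transition c d.
have phis : smooth_on W phi := atlas_smooth ac ad.
have iphi z : W z -> img d (phi z) by move=> [_ dz]; exact: coord_img.
have sd := smooth_chart ad; have sc := smooth_chart ac.
have Dcomp (h : 'rV[R]_2 -> 'rV[R]_4) z v : smooth_on (img d) h -> W z ->
    is_derive z v (h \o phi) (('D_v phi z) 0 0 *: pd 0 h (phi z) + ('D_v phi z) 0 1 *: pd 1 h (phi z)).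
  move=> hs Wz; have dphi : differentiable phi z := (phis 1%N).1 z Wz.
  have dh : differentiable h (phi z) := (hs 1%N).1 _ (iphi z Wz).
  apply: DeriveDef; last exact: derive_comp_rV2.
  by apply: diff_derivable; exact: differentiable_comp.
pose J i k z := (pd i phi z) 0 k.
have fE z i : W z -> f c z i = J i 0 z *: f d (phi z) 0 + J i 1 z *: f d (phi z) 1.
  move=> Wz; have [iz dz] := Wz.
  apply: (is_derive_unique_on oW Wz _ _ (Dcomp _ z (delta_mx 0 i) sd Wz)).
    2: exact: (smooth_is_derive _ sc iz).
  by move=> w [_ dw]; rewrite /= /phi /transition /= (coordK dw).
have fE2 i j : f2 c u i j =
    (pd i (pd j phi) u 0 0 *: f d (phi u) 0 +
      J j 0 u *: (J i 0 u *: f2 d (phi u) 0 0 + J i 1 u *: f2 d (phi u) 1 0)) +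
    (pd i (pd j phi) u 0 1 *: f d (phi u) 1 +
      J j 1 u *: (J i 0 u *: f2 d (phi u) 0 1 + J i 1 u *: f2 d (phi u) 1 1)).
  apply: (is_derive_unique_on (v := delta_mx 0 i) oW Wu (fun z => @fE z j)).
    by apply: smooth_is_derive iu; apply: smooth_derive.
  have dJ k : is_derive u (delta_mx 0 i : 'rV[R]_2) (J j k) (pd i (pd j phi) u 0 k).
    by apply: is_derive_coord; apply: smooth_is_derive Wu; apply: smooth_derive.
  apply: is_deriveD; apply: is_derive_scale.
  - exact: (Dcomp (pd 0 (F d)) u (delta_mx 0 i) (smooth_derive _ sd) Wu).
  - exact: (Dcomp (pd 1 (F d)) u (delta_mx 0 i) (smooth_derive _ sd) Wu).
have d0 : det2 (gram (f c u)) != 0 by rewrite gt_eqF // (gram_pos ac iu).2.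
exact: (laplace_change (J := fun i k => J i k u)
  (K := fun i j k => pd i (pd j phi) u 0 k) d0 (fun i => @fE u i Wu) fE2).
Qed.

(** Describes [L] at all points of a single chart, as is required once [L] is differentiated
    there. *)
Lemma laplace_chart c u : atlas c -> img c u ->
  normal_laplace c u (laplace_map g x (param c u)).
Proof.
move=> ac iu; have du := chart_at_dom (param c u).
apply: (normal_laplace_transition ac (chart_at_atlas _) iu du).
exact: laplace_chart_at.
Qed.

End Charts.

(** * Homotheties and minimality *)

Section Spheres.
Variables (R : realType) (n : nat).
Implicit Types (F : 'rV[R]_2 -> 'rV[R]_n) (a b : 'rV[R]_n) (U : set 'rV[R]_2).

Lemma sphere_minimal_span F a r u :
  let f i := pd i F u in
  det2 (gram f) != 0 -> r != 0 ->
  dot (F u - a) (F u - a) = r ^+ 2 -> (forall i, dot (F u - a) (f i) = 0) ->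
  sphere_mean_curvature a r F u = 0 <->
  exists mu t0 t1, cotrace (gram f) (fun i j => pd i (pd j F) u) =
    mu *: (F u - a) + t0 *: f 0 + t1 *: f 1.
Proof. by move=> f; exact: sff_trace_span. Qed.

Lemma sphere_derive U F a k u i : open U -> smooth_on U F -> U u ->
  (forall z, U z -> dot (F z - a) (F z - a) = k) ->
  dot (F u - a) (pd i F u) = 0.
Proof.
move=> oU sF Uu Fk.
have dF : is_derive u (delta_mx 0 i : 'rV[R]_2) (fun z => F z - a) (pd i F u).
  have D := is_deriveB (smooth_is_derive (delta_mx 0 i) sF Uu) (is_derive_cst a u (delta_mx 0 i)).
  by rewrite subr0 in D.
have := is_derive_unique_on oU Uu Fk (is_derive_dot dF dF) (is_derive_cst k u _).
by rewrite (dotC (pd i F u)); lra.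
Qed.

Lemma sphere_derive2 U F a k u i j : open U -> smooth_on U F -> U u ->
  (forall z, U z -> dot (F z - a) (F z - a) = k) ->
  dot (F u - a) (pd i (pd j F) u) = - dot (pd i F u) (pd j F u).
Proof.
move=> oU sF Uu Fk.
have dF : is_derive u (delta_mx 0 i : 'rV[R]_2) (fun z => F z - a) (pd i F u).
  have D := is_deriveB (smooth_is_derive (delta_mx 0 i) sF Uu) (is_derive_cst a u (delta_mx 0 i)).
  by rewrite subr0 in D.
have dF2 := smooth_is_derive (delta_mx 0 i) (smooth_derive (delta_mx 0 j) sF) Uu.
have := is_derive_unique_on oU Uu (fun z Uz => sphere_derive j oU sF Uz Fk)
  (is_derive_dot dF dF2) (is_derive_cst (0 : R) u _).
by move=> /eqP; rewrite addrC addr_eq0 => /eqP.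
Qed.

Lemma is_derive_homothety F k a b u v w : is_derive u v F w ->
  is_derive u v (fun z => k *: (F z - a) + b) (k *: w).
Proof.
move=> dF; have D := is_deriveD (is_deriveZ k (is_deriveB dF (is_derive_cst a u v)))
  (is_derive_cst b u v).
by rewrite subr0 addr0 in D.
Qed.

End Spheres.

(** [h] is locally constant by the mean value theorem, so its level sets are open and closed. *)
Lemma derive_zero_cst (R : realType) (M : surface R) n (h : M -> 'rV[R]_n) :
  (forall c u v, atlas c -> img c u -> is_derive u v (h \o param c) 0) ->
  forall p q, h p = h q.
Proof.
move=> dh.
have loc p : \forall q \near p, h q = h p.
  have ac := chart_at_atlas p; have dp := chart_at_dom p.
  set c := chart_at p in ac dp.
  have H : \forall z \near Defs.coord c p, (h \o param c) z = (h \o param c) (Defs.coord c p).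
    apply: (@cst_on_ball _ _ (img c)); [exact: img_open|exact: coord_img|].
    by move=> z v iz; exact: dh.
  have H' := Defs.coord_continuous dp H.
  have Dp : nbhs p (dom c) := open_nbhs_nbhs (conj (@dom_open _ _ c) dp).
  have H2 : nbhs p [set q | h (param c (Defs.coord c q)) = h (param c (Defs.coord c p))] := H'.
  apply: filterS (filterI H2 Dp) => q [/= + dq].
  by rewrite (coordK dp) (coordK dq).
move=> p q; pose A : set M := [set p | h p = h q].
suff : A = setT by move=> E; have : A p by rewrite E.
apply: (surface_connected (B := A)).
- by exists q.
- exists A; last by rewrite setTI.
  by rewrite openE => z Az; apply: filterS (loc z) => w; rewrite /A /= => ->.
- exists A; last by rewrite setTI.
  rewrite -openC openE => z Az; apply: filterS (loc z) => w.
  by rewrite /A /setC /= => ->.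
Qed.

(** In the span criterion [cotrace] scales by the cube of [k], position and tangent vectors by [k];
    the coefficients therefore scale by [k ^+ 2]. *)
Lemma minimal_homothety (R : realType) (M : surface R) n (f f' : M -> 'rV[R]_n)
    (a b : 'rV[R]_n) (k r : R) :
  (forall c u, atlas c -> img c u ->
     det2 (gram (fun i => pd i (f \o param c) u)) != 0) ->
  0 < k -> (forall p, f' p = k *: (f p - a) + b) ->
  minimal_in_hypersphere f a r -> minimal_in_hypersphere f' b (k * r).
Proof.
move=> f0 k0 f'E [r0 [fs fi] fS fm].
have E c : f' \o param c = (fun z => k *: ((f \o param c) z - a) + b).
  by apply/funext => z /=; rewrite f'E.
have d1 c u v : atlas c -> img c u ->
    is_derive u v (f' \o param c) (k *: 'D_v (f \o param c) u).
  move=> ac iu; rewrite E; apply: is_derive_homothety.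
  exact: smooth_is_derive (fs c ac) iu.
have D1 c u v : atlas c -> img c u -> 'D_v (f' \o param c) u = k *: 'D_v (f \o param c) u.
  by move=> ac iu; have [_ ->] := d1 c u v ac iu.
have D2 c u v w : atlas c -> img c u ->
    'D_w ('D_v (f' \o param c)) u = k *: 'D_w ('D_v (f \o param c)) u.
  move=> ac iu.
  have [_ <-] := is_deriveZ k (smooth_is_derive w (smooth_derive v (fs c ac)) iu).
  apply: near_eq_derive.
  by apply: filterS (open_nbhs_nbhs (conj (@img_open _ _ c) iu)) => z iz; exact: D1.
have f's : smooth_map f'.
  move=> c ac; have oc := @img_open _ _ c.
  have := smooth_subc (- b) oc (smooth_scale k oc (smooth_subc a oc (fs c ac))).
  by rewrite opprK E.
have f'S p : hypersphere b (k * r) (f' p).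
  by rewrite /hypersphere /= f'E addrK dotZl dotZr (fS p) exprMn mulrA -expr2.
split; [exact: mulr_gt0| |exact: f'S|].
  split; [exact: f's|move=> c p ac dp v w vw; have ip := coord_img dp].
  apply: (fi c p ac dp); apply: (scalerI (lt0r_neq0 k0)).
  exact: etrans (esym (D1 c _ v ac ip)) (etrans vw (D1 c _ w ac ip)).
move=> c p ac dp; have iu := coord_img dp; set u := Defs.coord c p in iu *.
have oc := @img_open _ _ c.
have gE : gram (fun i => pd i (f' \o param c) u) =
    k ^+ 2 *: gram (fun i => pd i (f \o param c) u).
  rewrite -gramZ; congr gram; apply/funext => i; exact: D1.
have kn0 := lt0r_neq0 k0.
have kr0 : k * r != 0 by rewrite mulf_neq0 // gt_eqF.
apply/sphere_minimal_span => //.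
- by rewrite gE det2Z mulf_neq0 ?f0 // !expf_neq0.
- exact: f'S.
- move=> i; apply: (@sphere_derive _ _ _ _ b ((k * r) ^+ 2) u i oc (f's c ac) iu).
  by move=> z _; exact: f'S.
have := fm c p ac dp; rewrite -/u => /sphere_minimal_span.
case=> //; first exact: f0.
- by rewrite gt_eqF.
- exact: fS.
- move=> i; apply: (@sphere_derive _ _ _ _ a (r ^+ 2) u i oc (fs c ac) iu).
  by move=> z _; exact: fS.
move=> mu [t0 [t1 T]]; exists (k ^+ 2 * mu), (k ^+ 2 * t0), (k ^+ 2 * t1).
have -> : (fun i j => pd i (pd j (f' \o param c)) u) =
    (fun i j => k *: pd i (pd j (f \o param c)) u).
  by apply/funext => i; apply/funext => j; exact: D2.
rewrite gE cotraceZl cotraceZr T.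
have -> : (f' \o param c) u - b = k *: ((f \o param c) u - a) by rewrite /= f'E addrK.
have DE i : pd i (f' \o param c) u = k *: pd i (f \o param c) u by exact: D1.
rewrite (DE 0) (DE 1).
have alg (y v w : 'rV[R]_n) : k ^+ 2 *: (k *: (mu *: y + t0 *: v + t1 *: w)) =
    (k ^+ 2 * mu) *: (k *: y) + (k ^+ 2 * t0) *: (k *: v) + (k ^+ 2 * t1) *: (k *: w).
  by apply/rowP => j; rewrite !mxE; ring.
exact: alg.
Qed.

Lemma conformal_normal_pd (R : realType) (U : set 'rV[R]_2)
    (F L : 'rV[R]_2 -> 'rV[R]_4) (r : R) :
  let f u i := pd i F u in let l u i := pd i L u in
  let f2 u i j := pd i (pd j F) u in let l2 u i j := pd i (pd j L) u in
  open U -> 0 < r -> smooth_on U F -> smooth_on U L ->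
  (forall u, U u -> 0 < dot (f u 0) (f u 0) /\ 0 < det2 (gram (f u))) ->
  (forall u, U u -> dot (L u) (L u) = r ^+ 2) ->
  (forall u, U u -> exists2 s, 0 < s & gram (l u) = s *: gram (f u)) ->
  (forall u, U u -> (forall i, dot (L u) (f u i) = 0) /\
    forall v, (forall i, dot v (f u i) = 0) ->
    dot v (cotrace (gram (f u)) (f2 u)) = - det2 (gram (f u)) * dot v (L u)) ->
  (forall u, U u -> exists mu t0 t1,
    cotrace (gram (l u)) (l2 u) = mu *: L u + t0 *: l u 0 + t1 *: l u 1) ->
  forall u i, U u -> l u i = (r ^+ 2 / 2) *: f u i.
Proof.
move=> f l f2 l2 oU r0 sF sL fpos LL conf lapl lspan u i Uu.
have cotrE (h : 'I_2 -> 'rV[R]_4) (B : 'I_2 -> 'I_2 -> 'rV[R]_4) : B 1 0 = B 0 1 ->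
    dot (h 1) (h 1) *: B 0 0 - (2 * dot (h 0) (h 1)) *: B 0 1 + dot (h 0) (h 0) *: B 1 1
    = cotrace (gram h) B.
  move=> B10; rewrite /cotrace !mxE B10 (dotC (h 1) (h 0)); congr (_ + _).
  by rewrite -addrA -opprD -scalerDl mulr_natl mulr2n.
have sfC (h : 'rV[R]_2 -> 'rV[R]_4) a b z : smooth_on U h -> U z ->
    pd a (pd b h) z = pd b (pd a h) z.
  by move=> sh Uz; exact: (schwarz _ _ oU sh Uz).
have sd (h : 'rV[R]_2 -> 'rV[R]_4) a : smooth_on U h -> smooth_on U (pd a h).
  exact: smooth_derive.
apply: (@conformal_normal_derive R _ U (fun i => delta_mx 0 i) L (fun i => pd i F) (fun i => pd i L)
  (fun i j => pd i (pd j F)) (fun i j => pd i (pd j L))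
  (fun i j k => pd i (pd j (pd k F))) r oU r0 _ _ _ _ _ _ _ _ LL _ _ _ _ _ i u Uu).
- by move=> a b z; apply: smooth_is_derive; exact: sd.
- by move=> a b c z; apply: smooth_is_derive; exact: (sd _ _ (sd _ _ sF)).
- by move=> a z; exact: smooth_is_derive.
- by move=> a b z; apply: smooth_is_derive; exact: sd.
- by move=> a b z; exact: sfC.
- by move=> a b z; exact: sfC.
- by move=> a b c z; apply: sfC; exact: sd.
- by move=> a z Uz; exact: (lapl z Uz).1.
- move=> z Uz; have [s s0 E] := conf z Uz; exists s => // a b.
  by have /matrixP /(_ a b) := E; rewrite !mxE.
- by move=> z Uz; exact: (fpos z Uz).1.
- by move=> z Uz; have := (fpos z Uz).2; rewrite det2_gram.
- move=> z Uz; have d0 := (fpos z Uz).2; have [lf lT] := lapl z Uz.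
  (* Adding [det2 (gram (f z)) *: L z] cancels the normal part of the trace. *)
  have [v vf|t0 [t1 E]] := @tangent_span _ _ (f z)
      (cotrace (gram (f z)) (f2 z) + det2 (gram (f z)) *: L z) (lt0r_neq0 d0).
    by rewrite dotDr dotZr lT // mulNr addNr.
  exists t0, t1; rewrite (cotrE (f z) (f2 z)); last exact: sfC.
  rewrite -addrA -/(f z 0) -/(f z 1) -E -(det2_gram (f z)) addrC.
  exact: (esym (addrK _ _)).
(* Minimality of [L] refers to its own metric, [s] times that of [F]; dividing by [s] gives the
   trace in the metric of [F]. *)
- move=> z Uz; have [s s0 E] := conf z Uz.
  have [mu [t0 [t1]]] := lspan z Uz; rewrite E cotraceZl => T.
  exists (s^-1 * mu), (s^-1 * t0), (s^-1 * t1).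
  rewrite (cotrE (f z) (l2 z)); last exact: sfC.
  rewrite -!(scalerA s^-1) -!scalerDr -/(l z 0) -/(l z 1) -T.
  exact: (esym (scalerK (lt0r_neq0 s0) _)).
Qed.

(** * The Laplace map and spherical minimality *)

Section Laplace.
Variables (R : realType) (M : surface R) (g : riemannian_metric M).
Variable x : M -> 'rV[R]_4.
Hypothesis hx : isometric_immersion g x.
Implicit Types (c : chart R M).

Local Notation L := (laplace_map g x).

Lemma conformal_gram c u : conformal g L -> atlas c -> img c u -> exists2 s, 0 < s &
  gram (fun i => pd i (L \o param c) u) = s *: gram (fun i => pd i (x \o param c) u).
Proof.
move=> [rho [rho0 E]] ac iu; exists (rho (param c u) ^+ 2); first exact: exprn_gt0.
rewrite (gram_gmat hx ac iu); apply/matrixP => i j; rewrite !mxE -bilin_delta.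
have := E c (param c u) (delta_mx 0 i) (delta_mx 0 j) ac (param_dom iu).
by rewrite /tangent_map (paramK iu).
Qed.

Lemma minimal_laplace a r : minimal_in_hypersphere x a r ->
  forall p, L p = (2 / r ^+ 2) *: (x p - a).
Proof.
move=> [r0 _ xS xm] p.
have ac := chart_at_atlas p; have dp := chart_at_dom p.
set c := chart_at p in ac dp; have iu := coord_img dp.
set u := Defs.coord c p in iu.
have [_ d_gt0] := gram_pos hx ac iu; have d0 := lt0r_neq0 d_gt0.
have := laplace_chart hx ac iu; rewrite (coordK dp) => Lc.
have Fp : (x \o param c) u = x p by rewrite /= (coordK dp).
have oc := @img_open _ _ c; have sc := smooth_chart hx ac.
have yf i : dot ((x \o param c) u - a) (pd i (x \o param c) u) = 0.
  by apply: (@sphere_derive _ _ _ _ a (r ^+ 2) u i oc sc iu) => z _; exact: xS.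
have yf2 i j : dot ((x \o param c) u - a) (pd i (pd j (x \o param c)) u) =
    - dot (pd i (x \o param c) u) (pd j (x \o param c) u).
  by apply: (@sphere_derive2 _ _ _ _ a (r ^+ 2) u i j oc sc iu) => z _; exact: xS.
have yy : dot ((x \o param c) u - a) ((x \o param c) u - a) = r ^+ 2 by exact: xS.
have := xm c p ac dp; rewrite -/u => /sphere_minimal_span; case=> //.
  exact: lt0r_neq0.
move=> mu [t0 [t1 T]]; rewrite -Fp.
exact: (laplace_of_sphere d0 (lt0r_neq0 r0) yy yf yf2 Lc T).
Qed.

(** [b] is the constant value of [x - k^-1 *: L], whose derivatives vanish in every chart. The term
    [- 0] records the center of the sphere in the form taken by [minimal_homothety]. *)
Lemma laplace_minimal r : conformal g L -> minimal_in_hypersphere L 0 r ->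
  exists b, forall p, x p = (r ^+ 2 / 2)^-1 *: (L p - 0) + b.
Proof.
move=> hL [r0 [Ls _] LS Lm].
have LS0 p : dot (L p) (L p) = r ^+ 2 by have := LS p; rewrite /hypersphere /mkset subr0.
set k := r ^+ 2 / 2; have k0 : k != 0.
  by rewrite mulf_neq0 ?invr_eq0 ?pnatr_eq0 // expf_neq0 // gt_eqF.
have [p0 _] := surface_nonempty M.
exists (x p0 - k^-1 *: L p0) => p.
suff E : x p - k^-1 *: L p = x p0 - k^-1 *: L p0 by rewrite subr0 -E addrC subrK.
apply: (derive_zero_cst (h := fun p => x p - k^-1 *: L p)) => c u v ac iu.
have oc := @img_open _ _ c; have sc := smooth_chart hx ac; have sL := Ls c ac.
have core i z : img c z -> pd i (L \o param c) z = k *: pd i (x \o param c) z.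
  apply: (conformal_normal_pd oc r0 sc sL) => [w|w iw|w|w|w] {z}.
  - exact: (gram_pos hx ac).
  - exact: LS0.
  - exact: conformal_gram.
  - exact: laplace_chart.
  - move=> iw; have [s s0 E] := conformal_gram hL ac iw.
    have := Lm c (param c w) ac (param_dom iw); rewrite (paramK iw).
    move=> /sphere_minimal_span; rewrite subr0; apply.
    + by rewrite E det2Z mulf_neq0 ?expf_neq0 ?gt_eqF // (gram_pos hx ac iw).2.
    + by rewrite gt_eqF.
    + exact: LS0.
    + move=> j; rewrite -[X in dot X _]subr0.
      by apply: (@sphere_derive _ _ _ _ 0 (r ^+ 2) w j oc sL iw) => z _; exact: LS.
have D := is_deriveB (smooth_is_derive v sc iu) (is_deriveZ k^-1 (smooth_is_derive v sL iu)).
apply: is_derive_eq D _.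
rewrite (derive_rV2 v ((sc 1%N).1 u iu)) (derive_rV2 v ((sL 1%N).1 u iu)).
rewrite (core 0 u iu) (core 1 u iu).
have alg (a b : R) (y z : 'rV[R]_4) :
    a *: y + b *: z - k^-1 *: (a *: (k *: y) + b *: (k *: z)) = 0.
  by apply/rowP => i; rewrite !mxE; field.
exact: alg.
Qed.

End Laplace.

Theorem theorem2p3 (R : realType) (M : surface R) (g : riemannian_metric M)
    (x : M -> 'rV[R]_4)
    (hx : isometric_immersion g x)
    (hL : conformal g (laplace_map g x)) :
  (exists r : R, minimal_in_hypersphere (laplace_map g x) 0 r) <->
  (exists (a : 'rV[R]_4) (r : R), minimal_in_hypersphere x a r).
Proof.
have xgram c u : atlas c -> img c u -> det2 (gram (fun i => pd i (x \o param c) u)) != 0.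
  by move=> ac iu; rewrite gt_eqF // (gram_pos hx ac iu).2.
split=> [[r Lm]|[a [r xm]]].
  have [b xE] := laplace_minimal hx hL Lm; have r0 : 0 < r by case: Lm.
  (* The radius is multiplied by the ratio of the homothety and equals [2 / r], here as in the
     converse. *)
  exists b, ((r ^+ 2 / 2)^-1 * r).
  apply: (minimal_homothety _ _ xE Lm).
    move=> c u ac iu; have [s s0 ->] := conformal_gram hx hL ac iu.
    by rewrite det2Z mulf_neq0 ?xgram // expf_neq0 // gt_eqF.
  by rewrite invr_gt0 divr_gt0 // exprn_gt0.
have r0 : 0 < r by case: xm.
exists (2 / r ^+ 2 * r).
apply: (minimal_homothety xgram _ _ xm).
  by rewrite divr_gt0 // exprn_gt0.
by move=> p; rewrite addr0; exact: minimal_laplace.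
Qed.
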